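(* Let $d\in\mathbb N$, let $X$ be a Polish space, let $\mathcal N\subset\mathbb Z^d$ be a finite symmetric set containing the origin, let $\alpha^*$ be a jump rate kernel on $X^{\mathcal N}$ with uniformly bounded total measure, and let $H:X^{\mathcal N}\to\mathbb R$ be measurable. Let $\tau>0$. Let $\nu$ be a probability measure on $X$, and suppose that for some $\gamma>1$, $$\sup_{A\in\mathcal B}E\big[|H(\xi_\tau^{A,\nu}|_{\mathcal N})|^\gamma\big]<\infty .$$ Then for any $\mathcal B$-valued sequence $(A_n)$ satisfying $|\partial_{\rm ext}A_n|/|A_n|\to0$ as $n\to\infty$ and $(\mathcal N_{A_n})^o=A_n$ for all $n$, we have as $n\to\infty$ $$|A_n|^{-1}S_H^{A_n}(\xi_\tau^{A_n,\nu})\xrightarrow{L^1}E\,H(\xi_\tau^\nu|_{\mathcal N}).$$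
   Context: Setting: $V=\mathbb Z^d$; $\mathcal N_v:=v+\mathcal N$ for $v\in\mathbb Z^d$; $L_v:X^{\mathcal N_v}\to X^{\mathcal N}$ is $(L_vx)(w)=x(w+v)$. $\alpha^*(x,dy)$ is a jump rate kernel on $X^{\mathcal N}$ (a measurable kernel of finite measures) whose total measure is bounded uniformly over $x\in X^{\mathcal N}$, and for $v\in\mathbb Z^d$, $\alpha_v^*(x,\Gamma)=\alpha^*(L_v(x),L_v(\Gamma))$ for $x\in X^{\mathcal N_v}$, $\Gamma$ Borel in $X^{\mathcal N_v}$. $X^{\mathbb Z^d}$ has the product topology and Borel $\sigma$-field. For $x\in X^{\mathbb Z^d}$, $y\in X^{\mathcal N_v}$, $x|v|y\in X^{\mathbb Z^d}$ agrees with $y$ on $\mathcal N_v$ and with $x$ elsewhere. $\mathcal C$ is the class of bounded measurable $f:X^{\mathbb Z^d}\to\mathbb R$ depending on finitely many coordinates. $G_vf(x)=\int_{X^{\mathcal N_v}}(f(x|v|y)-f(x))\alpha_v^*(x|_{\mathcal N_v},dy)$; for $A\subseteq\mathbb Z^d$, $G^A=\sum_{v\in A}G_v$, and $G=G^{\mathbb Z^d}$. There is a unique Markovian transition semigroup $(P_t)$ on $X^{\mathbb Z^d}$ with generator $G$ on $\mathcal C$ (i.e. $t^{-1}(P_tf-f)\to Gf$ uniformly as $t\downarrow0$ for $f\in\mathcal C$), and it is realised by a Markov family of processes whose sample paths are right-continuous with left limits. $\mathcal B$ is the collection of non-empty finite subsets of $\mathbb Z^d$. For $A\in\mathcal B$,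 $(\xi_t^{A,\nu},t\ge0)$ is the $X^{\mathbb Z^d}$-valued pure jump Markov process with generator $G^A$ whose initial state has i.i.d. entries $\xi_0^{A,\nu}(v)$, $v\in\mathbb Z^d$, with common distribution $\nu$. $(\xi_t^\nu,t\ge0)$ is the $X^{\mathbb Z^d}$-valued Markov process with transition semigroup $(P_t)$ (generator $G$) and initial state with i.i.d. entries of distribution $\nu$. For measurable $H:X^{\mathcal N}\to\mathbb R$ and $A\in\mathcal B$, $S_H^A(x)=\sum_{v\in A}H(L_v(x|_{\mathcal N_v}))$ for $x\in X^{\mathbb Z^d}$. For $A\subset\mathbb Z^d$: $A^c=\mathbb Z^d\setminus A$, $\mathcal N_A=\bigcup_{v\in A}\mathcal N_v$, $\partial_{\rm ext}A=\mathcal N_A\setminus A$, $A^o=\mathbb Z^d\setminus\mathcal N_{A^c}$, and $|A|$ is the cardinality.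
   Formalization: If N = {0}, the formal theorem also assumes |A_n| → ∞, since the claim fails e.g. for A_n = {0}, α* = 0 and H bounded, not ν-a.s. constant; if N ≠ {0}, this already follows from |∂_ext A_n|/|A_n| → 0. *)

(* Defs.v *)
From HB Require Import structures.
From mathcomp Require Import all_boot all_order all_algebra finmap.
From mathcomp Require Import all_classical all_reals all_analysis.

Set Implicit Arguments.
Unset Strict Implicit.
Unset Printing Implicit Defensive.

Import Order.TTheory GRing.Theory Num.Theory.
Import numFieldNormedType.Exports.

Local Open Scope classical_set_scope.
Local Open Scope ring_scope.

Definition is_metric (R : realType) (T : Type) (dist : T -> T -> R) : Prop :=
  [/\ forall x y, 0 <= dist x y,
      forall x y, dist x y = 0 <-> x = y,
      forall x y, dist x y = dist y x
    & forall x y z, dist x z <= dist x y + dist y z].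

Definition metric_cauchy (R : realType) (T : Type) (dist : T -> T -> R)
    (u : nat -> T) : Prop :=
  forall e : R, 0 < e -> exists n0 : nat, forall m n : nat,
    (n0 <= m)%N -> (n0 <= n)%N -> dist (u m) (u n) < e.

(* Separable and metrizable by a complete metric; the metric is not part of
   the structure. *)
Definition polish_space (R : realType) (X : topologicalType) : Prop :=
  (exists2 D : set X, countable D & dense D) /\
  (exists dist : X -> X -> R,
    [/\ is_metric dist,
        forall (x : X) (A : set X),
          nbhs x A <-> exists2 e : R, 0 < e & [set y | dist x y < e] `<=` A
      & forall u : nat -> X, metric_cauchy dist u ->
          exists l : X, u @ \oo --> l]).

Definition borel (X : ptopologicalType) := g_sigma_algebraType (@open X).

(* X^I with the product topology and the Borel sigma-field of that topology. *)
Definition config (I : Type) (X : Type) : Type := I -> X.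

HB.instance Definition _ (I : Type) (X : ptopologicalType) :=
  Pointed.copy (config I X) (I -> X).
HB.instance Definition _ (I : Type) (X : ptopologicalType) :=
  Topological.copy (config I X) (prod_topology (fun _ : I => X)).
HB.instance Definition _ (I : Type) (X : ptopologicalType) :=
  Measurable.copy (config I X) (g_sigma_algebraType (@open (config I X))).

Definition restr (V X : Type) (A : set V) (x : config V X) : config A X :=
  sigL A x.
Arguments restr {V X} A x.

Section lattice.
Variable d : nat.
Local Notation V := ('rV[int]_d).
Implicit Types (N A : set V) (v w : V).

Definition nbhd N v : set V := [set v + w | w in N].

Definition Nset N A : set V := \bigcup_(v in A) nbhd N v.

Definition ext_boundary N A : set V := Nset N A `\` A.

Definition interior_set N A : set V := ~` Nset N (~` A).

Definition fin_nonempty : set (set V) := [set A | finite_set A /\ A !=set0].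

(* Meaningful for finite sets only. *)
Definition cardf A : nat := #|` fset_set A|.

Lemma shift_in_nbhd N v (w : N) : val w + v \in nbhd N v.
Proof. by apply/mem_set; exists (val w); [exact: set_valP|rewrite addrC]. Qed.

Definition shift_config (X : Type) N v (x : config (nbhd N v) X) :
    config N X :=
  fun w : N => x (SigSub (shift_in_nbhd v w)).

(* x|v|y *)
Definition replace (X : Type) N v (x : config V X) (y : config (nbhd N v) X) :
    config V X :=
  fun w => match pselect (nbhd N v w) with
           | left wNv => y (SigSub (mem_set wNv))
           | right _ => x w
           end.

End lattice.

Section dynamics.
Variables (R : realType) (X : ptopologicalType) (d : nat).
Local Notation V := ('rV[int]_d).
Local Notation S := (config V X).
Variable N : set V.
Variable alpha : R.-fker (config N X) ~> (config N X).

(* The class of bounded measurable functions of finitely many coordinates. *)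
Definition cylinder_fun (f : S -> R) : Prop :=
  [/\ measurable_fun [set: S] f,
      exists M : R, forall x, `|f x| <= M
    & exists2 D : set V, finite_set D &
        forall x y : S, (forall v, D v -> x v = y v) -> f x = f y].

Definition alpha_at (v : V) (x : config (nbhd N v) X)
    (B : set (config (nbhd N v) X)) : \bar R :=
  alpha (shift_config x) (@shift_config d X N v @` B).

Definition gen_site (v : V) (f : S -> R) (x : S) : R :=
  fine (\int[alpha_at (restr (nbhd N v) x)]_y (f (replace x y) - f x)%:E)%E.

(* For f in cylinder_fun only finitely many summands are nonzero, even for
   A = [set: V]. *)
Definition gen (A : set V) (f : S -> R) (x : S) : R :=
  \sum_(v \in A) gen_site v f x.

(* Only the values P t with 0 <= t matter. *)
Definition markov_semigroup (P : R -> R.-pker S ~> S) : Prop :=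
  (forall x (B : set S), measurable B -> P 0 x B = \d_x B) /\
  (forall s t : R, 0 <= s -> 0 <= t -> forall x (B : set S), measurable B ->
     P (s + t) x B = (\int[P s x]_y P t y B)%E).

Definition semigroup_op (P : R -> R.-pker S ~> S) (t : R) (f : S -> R)
    (x : S) : R := fine (\int[P t x]_y (f y)%:E)%E.

Definition has_generator (P : R -> R.-pker S ~> S)
    (G : (S -> R) -> S -> R) : Prop :=
  forall f, cylinder_fun f -> forall e : R, 0 < e ->
    \forall t \near 0^'+, forall x,
      `|t^-1 * (semigroup_op P t f x - f x) - G f x| < e.

Definition statistic (H : config N X -> R) (A : set V) (x : S) : R :=
  \sum_(v \in A) H (shift_config (restr (nbhd N v) x)).

Section process.
Variables (dT : measure_display) (T : measurableType dT) (Pr : probability T R).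

Definition past (xi : R -> T -> S) (s : R) : set (set T) :=
  <<s [set E | exists (u : R) (B : set S),
         [/\ 0 <= u <= s, measurable B & E = xi u @^-1` B]] >>.

(* Pr[xi_t \in B | F_s] = P_(t-s)(xi_s, B), with (F_s) the natural filtration
   of xi, stated through the integrals over the events of F_s. *)
Definition markov_process (P : R -> R.-pker S ~> S) (xi : R -> T -> S) : Prop :=
  (forall t : R, 0 <= t -> measurable_fun [set: T] (xi t)) /\
  (forall s t : R, 0 <= s -> s <= t -> forall E, past xi s E ->
     forall B : set S, measurable B ->
       Pr (E `&` xi t @^-1` B) = (\int[Pr]_(w in E) P (t - s)%R (xi s w) B)%E).

Definition iid_entries (nu : probability (borel X) R) (x0 : T -> S) : Prop :=
  (forall v (B : set (borel X)), measurable B ->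
     Pr [set w | B (x0 w v)] = nu B) /\
  (forall (J : {fset V}) (B : V -> set (borel X)),
     (forall v, measurable (B v)) ->
     Pr (\bigcap_(v in [set` J]) [set w | B v (x0 w v)]) =
     (\prod_(v <- J) Pr [set w | B v (x0 w v)])%E).

(* Right-continuous step function: constant just after each time and just
   before each positive time. *)
Definition step_path (z : R -> S) : Prop :=
  (forall t : R, 0 <= t -> \forall s \near t^'+, z s = z t) /\
  (forall t : R, 0 < t -> exists y : S, \forall s \near t^'-, z s = y).

Definition cadlag_path (z : R -> S) : Prop :=
  (forall t : R, 0 <= t -> z s @[s --> t^'+] --> z t) /\
  (forall t : R, 0 < t -> cvg (z s @[s --> t^'-])).

(* xi is the pure jump Markov process with generator G^A, A finite, started
   from i.i.d. entries. *)
Definition jump_process (A : set V) (nu : probability (borel X) R)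
    (xi : R -> T -> S) : Prop :=
  [/\ exists P, [/\ markov_semigroup P, has_generator P (gen A)
                  & markov_process P xi],
      {ae Pr, forall w, step_path (xi ^~ w)}
    & iid_entries nu (xi 0)].

(* xi is the Markov process with semigroup P started from i.i.d. entries. *)
Definition limit_process (P : R -> R.-pker S ~> S)
    (nu : probability (borel X) R) (xi : R -> T -> S) : Prop :=
  [/\ markov_process P xi,
      {ae Pr, forall w, cadlag_path (xi ^~ w)}
    & iid_entries nu (xi 0)].

End process.
End dynamics.

(* Main.v *)
Require Import Defs.
From HB Require Import structures.
From mathcomp Require Import all_boot all_order all_algebra finmap.
From mathcomp Require Import all_classical all_reals all_analysis.
From mathcomp Require Import measurable_realfun ring lra.

(* For bounded cylinder functions f, g with small support, the quantities
   T_t f(x) - T_t f(x') (x = x' near the support of f), T^A_t f(x) - T_t f(x)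
   (A large near the support) and T_t(fg)(x) - T_t f(x) T_t g(x) (distant
   supports) vanish at t = 0 and have as derivative a sum of at most q m quantities
   of the same kind, where q = |N| and m bounds the supports, which grow by q
   sites and by one layer of N. If the supports are n layers away from trouble,
   n iterations give a bound of order 2^(m - n), for t below a threshold depending
   only on q and the total jump rate. Hence a short time step is local,
   decorrelating and insensitive to far away inactive sites, uniformly in A; these
   properties compose, so they hold at time tau. A second moment computation gives
   the weak law of large numbers for bounded local functions, sites close to the
   boundary being negligible; for H one truncates, the gamma-moments
   of all sites being controlled by translation covariance. *)

Set Implicit Arguments.
Unset Strict Implicit.
Unset Printing Implicit Defensive.

Import Order.TTheory GRing.Theory Num.Theory.
Import numFieldNormedType.Exports.

Local Open Scope classical_set_scope.
Local Open Scope ring_scope.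

(** The dynamics are known only through their generators on cylinder functions: there is no
    graphical construction or coupling to work with, and the semigroups for the various [A] come
    from separate existence statements. Every comparison is therefore drawn from derivatives,
    translation covariance included: iterated differentiation forces the difference of two
    semigroups with corresponding generators to be 0. The n-fold iteration produces (2 c q)^n m (m +
    q) ... (m + (n - 1) q) / n!; the linear growth of the supports cancels the factorial up to a
    geometric factor, which is why the step must be short and why [tau] is cut into equal steps.
    After one step a cylinder function is no longer one, so locality is stated up to an error e,
    with a range depending only on e and the size of the support; this uniformity is what survives
    composition. The product initial law enters the same calculus as a step with constant output.
    The processes live on unrelated probability spaces, but L1 convergence to a constant concerns
    only their laws at time [tau]. *)

Lemma polish_second_countable (R : realType) (X : topologicalType) :
  polish_space R X -> @second_countable X.
Proof.
move=> [[D cD dD] [dist [[dist_ge0 dist0 distC dist_tri] nbhs_dist _]]].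
pose ball (z : X) (n : nat) := [set y | dist z y < n.+1%:R^-1 :> R].
exists [set ball p.1 p.2 | p in D `*` [set: nat]].
  apply: (@sub_countable _ _ _ (D `*` [set: nat])); first exact: card_image_le.
  by apply: countableX => //; exact: countableP.
have oball z n : open (ball z n).
  rewrite openE => y /= zy; apply/nbhs_dist.
  exists (n.+1%:R^-1 - dist z y); first by rewrite subr_gt0.
  move=> w /= yw; rewrite /ball /=.
  by apply: le_lt_trans (dist_tri z y w) _; rewrite -ltrBrDl.
split; first by move=> _ [[z n] _ <-]; exact: oball.
move=> x A /nbhs_dist[e e0 eA].
have [n ne] : exists n : nat, n.+1%:R^-1 < e / 2.
  have /= := @near_infty_natSinv_lt R (PosNum (divr_gt0 e0 (ltr0n R 2))).
  by case=> n _ /(_ n (leqnn n)) ?; exists n.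
have xx : ball x n x.
  by rewrite /ball /= (iffRL (dist0 x x) erefl) invr_gt0 ltr0n.
have [z [xz Dz]] := dD (ball x n) (ex_intro _ x xx) (oball x n).
exists (ball z n).
  by split; [exists (z, n)|rewrite /ball /= distC].
move=> y /= zy; apply: eA => /=.
apply: le_lt_trans (dist_tri x z y) _.
by rewrite (splitr e); apply: ltrD; apply: lt_trans ne.
Qed.

(** * Borel structure of configuration spaces *)

Section config_measurability.
Variables (I : eqType) (X : ptopologicalType).
Hypotheses (cI : countable [set: I]) (cX : @second_countable X).

Definition coord_sets : set (set (config I X)) :=
  [set E | exists i (B : set (borel X)), measurable B /\ E = [set x | B (x i)]].

(** With countably many sites and a countable base, the basic boxes are coded by finite lists of
    pairs of numbers, hence form a countable family. An open set is the union of the boxes that it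
    contains, so the product topology creates no Borel sets beyond the product sigma-field. *)
Lemma open_coord_sets (U : set (config I X)) : open U -> <<s coord_sets >> U.
Proof.
move: cI cX => /countable_injP[f finj] [bs /countable_injP[g ginj] [obs bbs]] oU.
pose box (s : seq (nat * nat)) : set (config I X) :=
  [set x | forall i b, bs b -> (f i, g b) \in s -> b (x i)].
pose SG := g_sigma_algebraType coord_sets.
have mbox s : measurable (box s : set SG).
  have -> : box s = \bigcap_(k in [set` s])
     [set x | forall i b, bs b -> (f i, g b) = k -> b (x i)].
    apply/seteqP; split => x /= h; first by move=> k ks i b bb E; apply: h; rewrite ?E.
    by move=> i b bb ks; exact: (h _ ks i b bb).
  apply: (@fin_bigcap_measurable _ SG) => [|k _]; first exact: finite_seq.
  have [[i [b [bb ibk]]]|nk] := pselect (exists i b, bs b /\ (f i, g b) = k).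
    rewrite (_ : [set _ | _] = [set x | b (x i)]).
      apply: sub_sigma_algebra; exists i, b; split => //.
      by apply: sub_sigma_algebra; exact: obs.
    apply/seteqP; split => x /= h; first exact: h.
    move=> i' b' bb'; rewrite -ibk => -[/finj ii' /ginj bb''].
    by rewrite ii' ?inE// bb'' ?inE.
  rewrite (_ : [set _ | _] = setT) //; apply/seteqP; split => // x _ i b bb ibk.
  by case: nk; exists i, b.
have -> : U = \bigcup_(s in [set s | box s `<=` U]) box s.
  apply/seteqP; split => [x Ux|x [s /= sU /sU//]].
  (* The boxes around [x] generate a filter; [cvg_sup] reduces its convergence to [x] in the product
     topology to one coordinate at a time. *)
  pose F := filter_from [set s | box s x] box.
  have FF : Filter F.
    apply: filter_from_filter; first by exists [::].
    move=> s t /= xs xt; exists (s ++ t).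
      by move=> i b bb; rewrite mem_cat => /orP[/xs|/xt]; exact.
    by move=> y h; split => i b bb k; apply: h => //; rewrite mem_cat k ?orbT.
  suff : F --> (x : config I X).
    by move=> /(_ U) []; [exact: open_nbhs_nbhs|move=> s xs sU; exists s].
  apply/cvg_sup => i A [_ [[B oB <-] Bx] sA].
  have [b [bb bx] bB] := bbs (x i) B (open_nbhs_nbhs (conj oB Bx)).
  exists [:: (f i, g b)].
    move=> i' b' bb'; rewrite inE => /eqP[/finj ii' /ginj bb''].
    by rewrite ii' ?inE// bb'' ?inE.
  by move=> y hy; apply/sA/bB; apply: (hy i b bb); rewrite inE.
rewrite bigcup_mkcond; apply: (@countable_bigcupT_measurable _ SG) => // s.
by case: ifP => _; [exact: mbox|exact: measurable0].
Qed.

Lemma measurable_configE : @measurable _ (config I X) = <<s coord_sets >>.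
Proof.
apply/seteqP; split.
  apply: smallest_sub; first exact: smallest_sigma_algebra.
  exact: open_coord_sets.
apply: smallest_sub; first exact: sigma_algebra_measurable.
move=> _ [i [B [mB ->]]].
have : measurable_fun setT (fun x : config I X => x i : borel X).
  apply: (@measurability _ _ _ (borel X) setT _ (@open X)) => // _ [W oW <-]; rewrite setTI.
  suff oW' : open ((fun x : config I X => x i) @^-1` W).
    exact: sub_sigma_algebra.
  apply: open_comp => // x _.
  exact: (@proj_continuous I (fun=> X) i x).
by move=> /(_ measurableT B mB); rewrite setTI.
Qed.

Lemma measurable_coord (i : I) :
  measurable_fun setT (fun x : config I X => x i : borel X).
Proof.
move=> _ B mB; rewrite setTI measurable_configE.
by apply: sub_sigma_algebra; exists i, B.
Qed.

Lemma measurable_config d (T : measurableType d) (h : T -> config I X) :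
  (forall i, measurable_fun setT (fun t => h t i : borel X)) ->
  measurable_fun setT h.
Proof.
move=> mh; apply: (measurability coord_sets); first exact: measurable_configE.
move=> _ [_ [i [B [mB ->]]] <-].
exact: (mh i measurableT B mB).
Qed.

End config_measurability.

Section boxes.
Variables (R : realType) (I : choiceType) (X : ptopologicalType).
Hypotheses (cI : countable [set: I]) (cX : @second_countable X).

(** Boxes over finitely many sites are stable under intersection and generate the Borel sets, so
    they determine a finite measure. *)
Lemma eq_on_boxes (m1 m2 : {measure set (config I X) -> \bar R}) :
  (m1 setT < +oo)%E ->
  (forall (J : {fset I}) (B : I -> set (borel X)), (forall i, measurable (B i)) ->
     m1 [set x | forall i, i \in J -> B i (x i)] =
     m2 [set x | forall i, i \in J -> B i (x i)]) ->
  forall E, measurable E -> m1 E = m2 E.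
Proof.
move=> fm1 m12.
pose G : set (set (config I X)) := [set E | exists (J : {fset I})
  (B : I -> set (borel X)), (forall i, measurable (B i)) /\
  E = [set x | forall i, i \in J -> B i (x i)]].
have GT : G setT.
  exists fset0, (fun=> setT); split => [i|]; first exact: measurableT.
  by apply/seteqP; split.
have Gm : G `<=` measurable.
  move=> _ [J [B [mB ->]]].
  rewrite (_ : [set _ | _] = \bigcap_(i in [set` J]) [set x | B i (x i)]).
    apply: fin_bigcap_measurable => [|i _]; first exact: finite_fset.
    by have := measurable_coord cI cX i measurableT (mB i); rewrite setTI.
  by apply/seteqP; split => x /= h.
apply: (measure_unique G (fun=> setT)) => //.
- apply/seteqP; split; last first.
    by apply: smallest_sub => //; exact: sigma_algebra_measurable.
  rewrite (measurable_configE cI cX); apply: smallest_sub.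
    exact: smallest_sigma_algebra.
  move=> _ [i [B [mB ->]]]; apply: sub_sigma_algebra.
  exists [fset i]%fset, (fun=> B); split => //.
  apply/seteqP; split => x /= h; last by apply: h; rewrite inE.
  by move=> j; rewrite inE => /eqP ->.
- move=> _ _ [J [B [mB ->]]] [J' [B' [mB' ->]]].
  exists (J `|` J')%fset, (fun i => (if i \in J then B i else setT) `&`
                                    (if i \in J' then B' i else setT)).
  split.
    by move=> i; apply: measurableI; case: ifP => // _; exact: measurableT.
  apply/seteqP; split => x /=.
    move=> [h h'] i _; split; case: ifP => //; [exact: h|exact: h'].
  move=> h; split => i iJ.
    by have := (h i); rewrite inE iJ /= => /(_ isT) [].
  by have := (h i); rewrite inE iJ orbT /= => /(_ isT) [].
- by apply/seteqP; split => // x _; exists 0%N.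
- by move=> _ [J [B [mB ->]]]; exact: m12.
Qed.

End boxes.

(** * Bounded measurable functions *)

Section bounded_measurable.
Context {R : realType} {d} {T : measurableType d}.
Implicit Types (f g : T -> R) (M : R).

(** The bound is part of the predicate because the iteration below has to track it: each application
    of the generator at a site multiplies it by 2 c. *)
Definition bdm M f := measurable_fun [set: T] f /\ forall x, `|f x| <= M.

Lemma bdm_ge0 M f : bdm M f -> 0 <= M.
Proof. by move=> [_ /(_ point)]; apply: le_trans. Qed.

Lemma bdm_cst r : bdm `|r| (fun=> r).
Proof. by split. Qed.

Lemma bdmD M M' f g : bdm M f -> bdm M' g -> bdm (M + M') (fun x => f x + g x).
Proof.
move=> [mf fM] [mg gM]; split; first exact: measurable_funD.
by move=> x; apply: le_trans (ler_normD _ _) _; exact: lerD.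
Qed.

Lemma bdmN M f : bdm M f -> bdm M (fun x => - f x).
Proof.
move=> [mf fM]; split => [|x]; last by rewrite normrN.
exact: measurable_funN.
Qed.

Lemma bdmB M M' f g : bdm M f -> bdm M' g -> bdm (M + M') (fun x => f x - g x).
Proof. by move=> bf bg; exact: (bdmD bf (bdmN bg)). Qed.

Lemma bdmM M M' f g : bdm M f -> bdm M' g -> bdm (M * M') (fun x => f x * g x).
Proof.
move=> [mf fM] [mg gM]; split; first exact: measurable_funM.
by move=> x; rewrite normrM; apply: ler_pM.
Qed.

Lemma bdmZ M c f : bdm M f -> bdm (`|c| * M) (fun x => c * f x).
Proof. by move=> bf; apply: bdmM => //; exact: bdm_cst. Qed.

Lemma bdm_sum (J : Type) (r : seq J) (P : pred J) (F : J -> T -> R) M :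
  (forall j, P j -> bdm M (F j)) ->
  bdm ((count P r)%:R * M) (fun x => \sum_(j <- r | P j) F j x).
Proof.
move=> bF; elim: r => [|j r ih] /=.
  rewrite mul0r; under eq_fun do rewrite big_nil.
  by split => // x; rewrite normr0.
under eq_fun do rewrite big_cons.
have [Pj|_] := boolP (P j); last by rewrite add0n.
by rewrite natrD mulrDl mul1r; apply: bdmD => //; exact: bF.
Qed.

End bounded_measurable.

Section bounded_integral.
Context {R : realType} {d} {T : measurableType d}.
Variable mu : {measure set T -> \bar R}.
Hypothesis fmu : (mu setT < +oo)%E.
Implicit Types (f g : T -> R) (M : R).

Lemma bdm_integrable M f : bdm M f -> mu.-integrable setT (EFin \o f).
Proof.
move=> [mf fM]; apply: measurable_bounded_integrable => //.
exists M; split; first exact: num_real.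
by move=> x Mx y _; apply: le_trans (fM y) _; exact: ltW.
Qed.

Lemma bintD M M' f g : bdm M f -> bdm M' g ->
  \int[mu]_x (f x + g x) = \int[mu]_x f x + \int[mu]_x g x.
Proof. by move=> /bdm_integrable bf /bdm_integrable bg; exact: RintegralD. Qed.

Lemma bintB M M' f g : bdm M f -> bdm M' g ->
  \int[mu]_x (f x - g x) = \int[mu]_x f x - \int[mu]_x g x.
Proof. by move=> /bdm_integrable bf /bdm_integrable bg; exact: RintegralB. Qed.

Lemma bintZ M c f : bdm M f -> \int[mu]_x (c * f x) = c * \int[mu]_x f x.
Proof. by move=> /bdm_integrable bf; exact: RintegralZl. Qed.

Lemma bintZr M c f : bdm M f -> \int[mu]_x (f x * c) = (\int[mu]_x f x) * c.
Proof. by move=> /bdm_integrable bf; exact: RintegralZr. Qed.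

Lemma bint_le M M' f g : bdm M f -> bdm M' g -> (forall x, f x <= g x) ->
  \int[mu]_x f x <= \int[mu]_x g x.
Proof. by move=> /bdm_integrable bf /bdm_integrable bg fg; exact: le_Rintegral. Qed.

Lemma bint_norm M f : bdm M f -> `|\int[mu]_x f x| <= M * fine (mu setT).
Proof.
move=> bf; apply: le_trans (le_normr_Rintegral _ (bdm_integrable bf)) _ => //.
rewrite -Rintegral_cst //; apply: (@bint_le M `|M|) => [||x].
- by case: bf => mf fM; split => [|x]; [exact: measurableT_comp|rewrite normr_id].
- exact: bdm_cst.
- by case: bf.
Qed.

Lemma bint_norm1 M f : mu setT = 1%E -> bdm M f -> `|\int[mu]_x f x| <= M.
Proof. by move=> mu1 bf; have := bint_norm bf; rewrite mu1 mulr1. Qed.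

Lemma bint_sum (J : Type) (r : seq J) (P : pred J) (F : J -> T -> R) M :
  (forall j, P j -> bdm M (F j)) ->
  \int[mu]_x (\sum_(j <- r | P j) F j x) = \sum_(j <- r | P j) \int[mu]_x F j x.
Proof.
move=> bF; elim: r => [|j r ih] /=.
  under eq_Rintegral do rewrite big_nil.
  by rewrite big_nil Rintegral_cst// mul0r.
rewrite big_cons -ih; under eq_Rintegral do rewrite big_cons.
have [Pj|//] := boolP (P j); exact: (bintD (bF _ Pj) (bdm_sum r bF)).
Qed.

End bounded_integral.

Section kernels.
Context {R : realType} {d1 d2} {T1 : measurableType d1} {T2 : measurableType d2}.
Implicit Type k : R.-pker T1 ~> T2.

Lemma pker_fin k y : (k y setT < +oo)%E.
Proof. by rewrite prob_kernel ltry. Qed.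

Lemma bdm_kernel k M f : bdm M f -> bdm M (fun y => \int[k y]_x f x).
Proof.
move=> bf; have M0 := bdm_ge0 bf; split=> [|y]; last first.
  by apply: le_trans (bint_norm (pker_fin k y) bf) _; rewrite prob_kernel mulr1.
(* Adding the bound [M] makes the integrand non-negative, as measurability of a kernel integral
   demands; [k y] has mass 1, so [M] is simply subtracted afterwards. *)
have -> : (fun y => \int[k y]_x f x) =
    (fun y => fine (\int[k y]_x (f x + M)%:E) - M).
  apply/funext => y; rewrite -[fine _]/(Rintegral _ _ _).
  rewrite (bintD (pker_fin k y) bf (bdm_cst M)) Rintegral_cst// prob_kernel mulr1.
  by rewrite addrK.
apply: measurable_funB => //; apply: measurableT_comp => //.
apply: measurable_fun_integral_kernel.
- by move=> U mU; exact: measurable_kernel.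
- by move=> x; rewrite lee_fin -lerBlDr sub0r; case: bf => _ /(_ x); rewrite ler_norml => /andP[].
- by apply/measurable_EFinP; apply: measurable_funD => //; case: bf.
Qed.

(** Seen as a constant kernel from [unit], [mu] composes with [k] to the mixture, and the Tonelli
    formula for composed kernels applies. *)
Lemma ge0_integral_mixture (mu : {measure set T1 -> \bar R}) k
    (m : {measure set T2 -> \bar R}) (f : T2 -> \bar R) :
  (mu setT < +oo)%E ->
  (forall B, measurable B -> m B = \int[mu]_y k y B)%E ->
  (forall x, 0 <= f x)%E -> measurable_fun setT f ->
  (\int[m]_x f x = \int[mu]_y \int[k y]_x f x)%E.
Proof.
move=> fmu mE f0 mf.
pose l (_ : unit) : {measure set T1 -> \bar R} := mu.
have ml U : measurable U -> measurable_fun setT (l ^~ U).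
  by move=> _; exact: measurable_cst.
pose lk := isKernel.Build _ _ _ _ _ l ml.
have lf : measure_fam_uub l.
  exists (fine (mu setT) + 1) => -[]; rewrite -[ltLHS]fineK ?ge0_fin_numE//.
  by rewrite lte_fin ltrDl.
pose L0 : R.-ker unit ~> T1 := HB.pack l lk.
pose lfk := Kernel_isFinite.Build _ _ _ _ _ L0 lf.
pose L : R.-fker unit ~> T1 := HB.pack l lk lfk.
have <- := @integral_kcomp _ _ _ unit T1 T2 R L
  (@kernel.kernel_snd _ _ _ unit T1 T2 R k) tt f f0 mf.
by apply: eq_measure_integral => B mB _; rewrite mE.
Qed.

Lemma bint_mixture (mu : {measure set T1 -> \bar R}) k
    (m : {measure set T2 -> \bar R}) M f :
  (mu setT = 1)%E -> (m setT = 1)%E ->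
  (forall B, measurable B -> m B = \int[mu]_y k y B)%E ->
  bdm M f -> \int[m]_x f x = \int[mu]_y \int[k y]_x f x.
Proof.
move=> mu1 m1 mE bf.
have fm : (m setT < +oo)%E by rewrite m1 ltry.
have fmu : (mu setT < +oo)%E by rewrite mu1 ltry.
apply: (addIr M).
have := bintD fm bf (bdm_cst M); rewrite Rintegral_cst// m1 mulr1 => <-.
rewrite {1}/Rintegral (ge0_integral_mixture fmu mE)//; last 2 first.
- by move=> x; rewrite lee_fin -lerBlDr sub0r; case: bf => _ /(_ x); rewrite ler_norml => /andP[].
- by apply/measurable_EFinP; apply: measurable_funD => //; case: bf.
have bk := bdm_kernel k bf.
rewrite -{2}[M]mulr1 -[1]/(fine 1%E) -mu1 -Rintegral_cst//.
rewrite -(bintD fmu bk (bdm_cst M)) /Rintegral; congr fine.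
apply: eq_integral => y _.
rewrite -[LHS]fineK.
  rewrite -[fine _]/(Rintegral _ _ _).
  by rewrite (bintD (pker_fin k y) bf (bdm_cst M)) Rintegral_cst// prob_kernel mulr1.
apply: integrable_fin_num => //.
exact: (bdm_integrable (pker_fin k y) (bdmD bf (bdm_cst M))).
Qed.

End kernels.

(** * Geometry and the generator at a site *)

Section geometry.
Variables (d : nat) (N : set 'rV[int]_d).
Hypotheses (finN : finite_set N) (N0 : N 0) (symN : forall v, N v -> N (- v)).
Local Notation V := 'rV[int]_d.
Implicit Types (D E : {fset V}) (v w : V).
Local Open Scope fset_scope.

Definition dil D : {fset V} := [fset (v + w)%R | v in D, w in fset_set N].
Definition fat n D : {fset V} := iter n dil D.

Lemma dilP D v : reflect (exists2 w, w \in D & N (v - w)) (v \in dil D).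
Proof.
apply: (iffP idP) => [/imfset2P[/= w wD [u]]|[w wD Nvw]].
  by rewrite in_fset_set// inE => Nu ->; exists w => //; rewrite addrC addKr.
apply/imfset2P; exists w => //=; exists (v - w); last by rewrite addrC subrK.
by rewrite in_fset_set// inE.
Qed.

Lemma sub_dil D : D `<=` dil D.
Proof. by apply/fsubsetP => v vD; apply/dilP; exists v; rewrite ?subrr. Qed.

Lemma dilS D E : D `<=` E -> dil D `<=` dil E.
Proof.
by move=> /fsubsetP DE; apply/fsubsetP => v /dilP[w /DE wE Nvw]; apply/dilP; exists w.
Qed.

Lemma fatS n D E : D `<=` E -> fat n D `<=` fat n E.
Proof. by elim: n => //= n ih DE; apply/dilS/ih. Qed.

Lemma fat_add m n D : fat m (fat n D) = fat (m + n) D.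
Proof. by rewrite /fat iterD. Qed.

Lemma sub_fat n D : D `<=` fat n D.
Proof. by elim: n => //= n ih; exact: (fsubset_trans ih (sub_dil _)). Qed.

Lemma fat_mono m n D : (m <= n)%N -> fat m D `<=` fat n D.
Proof. by move=> /subnK <-; rewrite -fat_add; exact: sub_fat. Qed.

Lemma card_dil D : (#|` dil D| <= #|` fset_set N| * #|` D|)%N.
Proof.
rewrite /dil unlock size_seq_fset mulnC.
by apply: leq_trans (size_undup _) _; rewrite size_allpairs.
Qed.

Lemma card_fat n D : (#|` fat n D| <= #|` fset_set N| ^ n * #|` D|)%N.
Proof.
elim: n => [|n ih] /=; first by rewrite mul1n.
by apply: leq_trans (card_dil _) _; rewrite expnS -mulnA leq_mul2l ih orbT.
Qed.

Lemma card_nbhs_gt0 : (0 < #|` fset_set N|)%N.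
Proof. by rewrite cardfs_gt0; apply/fset0Pn; exists 0%R; rewrite in_fset_set// inE. Qed.

(** As N = - N, v lies in w + N exactly when w lies in v + N, so a dilation can be moved from one
    set to the other. *)
Lemma dil_disjoint D E : [disjoint dil D & E] = [disjoint D & dil E].
Proof.
apply/idP/idP => /fdisjointP h; apply/fdisjointP => v.
  move=> vD; apply/negP => /dilP[w wE Nvw].
  suff /h : w \in dil D by rewrite wE.
  by apply/dilP; exists v => //; rewrite -opprB; exact: symN.
move=> /dilP[w wD Nvw]; apply/negP => vE.
suff : w \notin dil E by move/negP; apply; apply/dilP; exists v => //; rewrite -opprB; exact: symN.
exact: h.
Qed.

Lemma fat_disjoint n D E : [disjoint fat n D & E] = [disjoint D & fat n E].
Proof.
elim: n D E => // n ih D E.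
by rewrite {1}/fat iterS dil_disjoint -/(fat n D) ih /fat -iterSr.
Qed.

Lemma fat1_sym n v w : (v \in fat n [fset w]) = (w \in fat n [fset v]).
Proof.
have := fat_disjoint n [fset w] [fset v].
by rewrite fdisjointX1 fdisjoint1X => /negb_inj.
Qed.

End geometry.

Section generator.
Variables (R : realType) (X : ptopologicalType) (d : nat).
Local Notation V := 'rV[int]_d.
Local Notation S := (config V X).
Variable N : set V.
Hypothesis cX : @second_countable X.
Hypotheses (finN : finite_set N) (N0 : N 0) (symN : forall v, N v -> N (- v)).
Variable alpha : R.-fker (config N X) ~> (config N X).
Variable c : R.
Hypothesis alphac : forall x, (alpha x setT < c%:E)%E.
Implicit Types (D E : {fset V}) (v w u : V) (f g : S -> R).

Definition translate u (x : S) : S := fun w => x (w + u).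

(** The jump [replace] with the new values read in the fixed space X^N instead of X^(v + N), so that
    all sites share the kernel [alpha] and no type depends on [v]. *)
Definition overwrite v (x : S) (z : config N X) : S :=
  fun w => match pselect (N (w - v)) with
           | left h => z (SigSub (mem_set h))
           | right _ => x w
           end.

Lemma countV : countable [set: V]. Proof. exact: countableP. Qed.

Lemma measurable_site v : measurable_fun setT (fun x : S => x v : borel X).
Proof. exact: measurable_coord (countV) cX v. Qed.

Lemma measurable_siteN (w : N) :
  measurable_fun setT (fun x : config N X => x w : borel X).
Proof. by apply: measurable_coord => //; exact: countableP. Qed.

Lemma measurable_into_S d' (T : measurableType d') (h : T -> S) :
  (forall v, measurable_fun setT (fun t => h t v : borel X)) ->
  measurable_fun setT h.
Proof. exact: (measurable_config countV cX). Qed.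

Lemma measurable_translate u : measurable_fun setT (translate u).
Proof. by apply: measurable_into_S => v; exact: measurable_site. Qed.

Lemma measurable_restr : measurable_fun setT (restr N : S -> config N X).
Proof.
apply: measurable_config => //; first exact: countableP.
by move=> w; exact: measurable_site.
Qed.

Lemma measurable_overwrite v :
  measurable_fun setT (fun p : S * config N X => overwrite v p.1 p.2).
Proof.
apply: measurable_into_S => w; rewrite /overwrite.
case: pselect => h.
  exact: (measurableT_comp (measurable_siteN _) measurable_snd).
exact: (measurableT_comp (measurable_site _) measurable_fst).
Qed.

Lemma translate_overwrite u v x z :
  translate u (overwrite v x z) = overwrite (v - u) (translate u x) z.
Proof.
apply/funext => w; rewrite /translate /overwrite.
have e : w - (v - u) = w + u - v by rewrite opprB addrA.
case: pselect => h; case: pselect => h' //.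
- by congr z; apply/val_inj; rewrite /= e.
- by case: h'; rewrite e.
- by case: h; rewrite -e.
Qed.

Lemma translate_translate u v x : translate u (translate v x) = translate (u + v) x.
Proof. by apply/funext => w; rewrite /translate addrA. Qed.

(** Inverse of [shift_config]. The default [point] is never read: a site of [nbhd N v] minus [v]
    lies in [N]. *)
Definition unshift v (z : config N X) : config (nbhd N v) X :=
  overwrite v (fun=> point) z \o set_val.
Arguments unshift v z : clear implicits.

Lemma shiftK v (y : config (nbhd N v) X) : unshift v (shift_config y) = y.
Proof.
apply/funext => w; rewrite /unshift /overwrite /=; case: pselect => [h|].
  by rewrite /shift_config; congr y; apply/val_inj; rewrite /= subrK.
by case; have [u Nu uw] := set_valP w; rewrite -[set_val w]/(val w) -uw addrC addKr.
Qed.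

Lemma unshiftK v (z : config N X) : shift_config (unshift v z) = z.
Proof.
apply/funext => w; rewrite /unshift /shift_config /overwrite /=.
case: pselect => [h|].
  by congr z; apply/val_inj; rewrite /= addrK.
by case; rewrite addrK; exact: set_valP.
Qed.

Lemma measurable_unshift v : measurable_fun setT (unshift v).
Proof.
apply: measurable_config => //; first exact: countableP.
move=> w; rewrite /unshift /overwrite /=; case: pselect => h //.
exact: measurable_siteN.
Qed.

Lemma replace_unshift v x z : replace x (unshift v z) = overwrite v x z.
Proof.
apply/funext => w; rewrite /replace /unshift /overwrite.
case: pselect => [h|h]; last first.
  case: pselect => // h'; case: h.
  by exists (w - v) => //; rewrite addrC subrK.
rewrite /=; case: pselect => // -[].
by rewrite -[set_val _]/w; have [u Nu <-] := h; rewrite addrC addKr.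
Qed.

(** The direct image of [B] under the bijection [shift_config] is its preimage under [unshift],
    which exhibits the set function [alpha_at] as a measure. *)
Lemma alpha_atE v x :
  alpha_at alpha (restr (nbhd N v) x) =
  pushforward (alpha (restr N (translate v x))) (unshift v).
Proof.
apply/funext => B; rewrite /alpha_at /pushforward; congr (alpha _ _).
apply/seteqP; split => [_ [y By <-]|z Bz] /=; first by rewrite shiftK.
by exists (unshift v z) => //; rewrite unshiftK.
Qed.

Lemma alpha_fin x : (alpha x setT < +oo)%E.
Proof. by apply: lt_trans (alphac x) _; rewrite ltry. Qed.

Lemma alpha_mass x : fine (alpha x setT) <= c.
Proof.
rewrite -lee_fin fineK; first exact: ltW.
by rewrite ge0_fin_numE ?alpha_fin.
Qed.

Lemma c_ge0 : 0 <= c.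
Proof. by apply: le_trans (alpha_mass point); apply: fine_ge0. Qed.

Lemma measurable_overwrite2 v x : measurable_fun setT (overwrite v x).
Proof. exact: (measurableT_comp (measurable_overwrite v) (pair1_measurable x)). Qed.

Lemma bdm_overwrite v x M f : bdm M f -> bdm M (fun z => f (overwrite v x z)).
Proof.
by move=> [mf fM]; split => //; exact: measurableT_comp mf (measurable_overwrite2 v x).
Qed.

(** The working form of the generator, with one kernel on one space for all sites, obtained by a
    change of variables along [unshift]. *)
Lemma gen_siteE v M f x : bdm M f ->
  gen_site alpha v f x =
  \int[alpha (restr N (translate v x))]_z (f (overwrite v x z) - f x).
Proof.
move=> bf; rewrite /gen_site alpha_atE /Rintegral; congr fine.
have bF := bdmB (bdm_overwrite v x bf) (bdm_cst (f x)).
have meq : measurable_fun setT (fun y : config (nbhd N v) X => f (replace x y) - f x).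
  apply: measurable_funB => //.
  apply: measurableT_comp; first by case: bf.
  apply: measurable_into_S => w; rewrite /replace; case: pselect => h //.
  by apply: measurable_coord => //; exact: countableP.
rewrite integral_pushforward//=.
- by apply: eq_integral => z _; rewrite /= replace_unshift.
- exact: measurable_unshift.
- exact/measurable_EFinP.
- rewrite (_ : _ \o _ = EFin \o (fun z => f (overwrite v x z) - f x)).
    exact: (bdm_integrable (alpha_fin _) bF).
  by apply/funext => z /=; rewrite replace_unshift.
Qed.

Lemma gen_site_bound v M f x : bdm M f -> `|gen_site alpha v f x| <= 2 * c * M.
Proof.
move=> bf; rewrite (gen_siteE _ _ bf).
have M0 := bdm_ge0 bf.
have bF : bdm (2 * M) (fun z => f (overwrite v x z) - f x).
  have [mF _] := bdmB (bdm_overwrite v x bf) (bdm_cst (f x)).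
  split => // z; apply: le_trans (ler_normB _ _) _.
  by rewrite mulr_natl mulr2n; apply: lerD; case: bf.
apply: le_trans (bint_norm (alpha_fin _) bF) _.
rewrite [leRHS]mulrAC; apply: ler_wpM2l; first exact: mulr_ge0.
exact: alpha_mass.
Qed.

Lemma measurable_gen_site v M f : bdm M f ->
  measurable_fun setT (gen_site alpha v f).
Proof.
move=> bf.
pose l x : {measure set (config N X) -> \bar R} := alpha (restr N (translate v x)).
have ml U : measurable U -> measurable_fun setT (l ^~ U).
  move=> mU; apply: (measurableT_comp (measurable_kernel alpha U mU)).
  exact: measurableT_comp measurable_restr (measurable_translate v).
pose lk := isKernel.Build _ _ _ _ _ l ml.
have lf : measure_fam_uub l by exists c => x; exact: alphac.
pose L0 : R.-ker S ~> config N X := HB.pack l lk.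
pose lfk := Kernel_isFinite.Build _ _ _ _ _ L0 lf.
pose L : R.-fker S ~> config N X := HB.pack l lk lfk.
have mF : measurable_fun setT (fun p : S * config N X => f (overwrite v p.1 p.2)).
  by apply: measurableT_comp (measurable_overwrite v); case: bf.
(* The summand [M] makes the integrand non-negative, so that kernel integration yields measurability
   in [x]; the second term takes [M] and [f x] away again. *)
have E x : gen_site alpha v f x = fine (\int[L x]_z (f (overwrite v x z) + M)%:E) -
    (M + f x) * fine (L x setT).
  rewrite (gen_siteE _ _ bf) -Rintegral_cst// -[fine (integral _ _ _)]/(Rintegral _ _ _).
  rewrite -(bintB (alpha_fin _) (bdmD (bdm_overwrite v x bf) (bdm_cst M)) (bdm_cst _)).
  by apply: eq_Rintegral => z _; rewrite opprD addrA addrK.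
rewrite (funext E).
apply: measurable_funB.
  apply: measurableT_comp => //.
  apply: (measurable_fun_integral_finite_kernel
    (fun p : S * config N X => (f (overwrite v p.1 p.2) + M)%:E) L).
    move=> p; rewrite lee_fin -lerBlDr sub0r.
    by case: bf => _ /(_ (overwrite v p.1 p.2)); rewrite ler_norml => /andP[].
  by apply/measurable_EFinP; apply: measurable_funD.
apply: measurable_funM; first by apply: measurable_funD => //; case: bf.
by apply: measurableT_comp => //; exact: (measurable_kernel L setT measurableT).
Qed.

Definition cyl D M f := bdm M f /\
  forall x y : S, (forall v, v \in D -> x v = y v) -> f x = f y.

Lemma cyl_sub D D' M f : (D `<=` D')%fset -> cyl D M f -> cyl D' M f.
Proof.
move=> /fsubsetP DD' [bf fD]; split => // x y xy.
by apply: fD => v /DD'; exact: xy.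
Qed.

Lemma cylM D D' M M' f g : cyl D M f -> cyl D' M' g ->
  cyl (D `|` D')%fset (M * M') (fun x => f x * g x).
Proof.
move=> [bf fD] [bg gD]; split; first exact: bdmM.
move=> x y xy; rewrite (fD x y) ?(gD x y)//.
- by move=> v vD; apply: xy; rewrite inE vD orbT.
- by move=> v vD; apply: xy; rewrite inE vD.
Qed.

Lemma cyl_cylinder D M f : cyl D M f -> cylinder_fun f.
Proof.
move=> [[mf fM] fD]; split => //; first by exists M.
by exists [set` D]; [exact: finite_fset|exact: fD].
Qed.

Lemma cyl_translate D M f u : cyl D M f ->
  cyl [fset (v + u)%R | v in D]%fset M (f \o translate u).
Proof.
move=> [[mf fM] fD]; split.
  by split => [|x /=] //; exact: measurableT_comp mf (measurable_translate u).
move=> x y xy; apply: fD => v vD; apply: xy.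
by apply/imfsetP; exists v.
Qed.

Lemma overwrite_out v w x z : w \notin dil N [fset v]%fset -> overwrite v x z w = x w.
Proof.
move=> wv; rewrite /overwrite; case: pselect => // h; case/negP: wv.
by apply/dilP => //; exists v; rewrite ?inE.
Qed.

Lemma in_dil v D : (v \in dil N D) = ~~ [disjoint dil N [fset v] & D]%fset.
Proof. by rewrite (dil_disjoint finN symN) fdisjoint1X negbK. Qed.

Lemma overwrite_notin v D M f x z : cyl D M f -> v \notin dil N D ->
  f (overwrite v x z) = f x.
Proof.
move=> [_ fD]; rewrite in_dil negbK => /fdisjointP vD.
apply: fD => w wD; apply: overwrite_out; apply/negP => /vD.
by rewrite wD.
Qed.

Lemma gen_site0 v D M f x : cyl D M f -> v \notin dil N D -> gen_site alpha v f x = 0.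
Proof.
move=> cf vD; rewrite (gen_siteE _ _ cf.1).
under eq_Rintegral do rewrite (overwrite_notin _ _ cf vD) subrr.
by rewrite Rintegral_cst// mul0r.
Qed.

(** A jump at [v] outside [dil N D'] leaves [g] unchanged, so [g] factors out of the integral: the
    Leibniz rule without a cross term. *)
Lemma gen_siteM v D D' M M' f g x : cyl D M f -> cyl D' M' g ->
  v \notin dil N D' ->
  gen_site alpha v (fun x => f x * g x) x = gen_site alpha v f x * g x.
Proof.
move=> cf cg vD'; rewrite (gen_siteE _ _ (bdmM cf.1 cg.1)) (gen_siteE _ _ cf.1).
rewrite -(bintZr (alpha_fin _) _ (bdmB (bdm_overwrite v x cf.1) (bdm_cst (f x)))).
by apply: eq_Rintegral => z _; rewrite (overwrite_notin _ _ cg vD') mulrBl.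
Qed.

Lemma gen_site_translate v u M f x : bdm M f ->
  gen_site alpha v (f \o translate u) x = gen_site alpha (v - u) f (translate u x).
Proof.
move=> bf; have bfu : bdm M (f \o translate u).
  case: bf => mf fM; split => [|y]; last exact: fM.
  exact: measurableT_comp mf (measurable_translate u).
rewrite (gen_siteE _ _ bfu) (gen_siteE _ _ bf) translate_translate subrK.
by apply: eq_Rintegral => z _; rewrite /= translate_overwrite.
Qed.

Lemma cyl_gen_site v D M f : cyl D M f ->
  cyl (D `|` dil N [fset v])%fset (2 * c * M) (gen_site alpha v f).
Proof.
move=> cf; split.
  split; first exact: measurable_gen_site cf.1.
  by move=> x; exact: gen_site_bound cf.1.
move=> x y xy; rewrite !(gen_siteE _ _ cf.1).
have -> : restr N (translate v x) = restr N (translate v y).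
  apply/funext => w; apply: xy; rewrite inE; apply/orP; right.
  apply/dilP => //; exists v; rewrite ?inE//.
  by rewrite addrK; exact: (set_valP w).
apply: eq_Rintegral => z _; congr (_ - _); last first.
  by apply: cf.2 => w wD; apply: xy; rewrite inE wD.
apply: cf.2 => w wD; rewrite /overwrite; case: pselect => // h.
by apply: xy; rewrite inE wD.
Qed.

(** Sites outside [dil N D] cannot change [f] and contribute 0. Any larger [E] is allowed, which
    leaves the choice of a convenient index set to the applications. *)
Lemma genE A D E M f x : cyl D M f -> (dil N D `<=` E)%fset ->
  gen alpha A f x = \sum_(v <- E | v \in A) gen_site alpha v f x.
Proof.
move=> cf /fsubsetP DE; rewrite /gen fsbig_supp.
rewrite (@fsbig_widen _ _ _ _ _ (A `&` [set` E])).
- rewrite fsbig_finite; last by apply: finite_setIr; exact: finite_fset.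
  rewrite -[RHS]big_filter; apply: perm_big.
  apply: uniq_perm; rewrite ?fset_uniq ?filter_uniq ?fset_uniq//.
  move=> v; rewrite mem_filter in_fset_set; last exact: finite_setIr (finite_fset _).
  by rewrite in_setI; congr (_ && _); apply/idP/idP; rewrite inE.
- move=> v [Av /= nz]; split => //=; apply: DE; apply: contrapT => /negP vD.
  by apply: nz; exact: gen_site0 cf vD.
- by move=> v [[Av vE] /= h]; apply: contrapT => nz; apply: h.
Qed.

End generator.

(** * Iterated differentiation *)

Section growth.
Variable R : realType.
Implicit Types (phi psi : R -> R) (s t h e : R).

(** A right derivative whose modulus is uniform in [s], with no continuity asked of [psi].
    Semigroups provide exactly this, and summing increments over a fine grid then takes the place of
    integration. *)
Definition udiff phi psi := forall e, 0 < e -> exists2 dl : R, 0 < dl &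
  forall s h, 0 <= s -> 0 < h < dl -> `|phi (s + h) - phi s - h * psi s| <= e * h.

Lemma udiffB phi psi phi' psi' : udiff phi psi -> udiff phi' psi' ->
  udiff (fun t => phi t - phi' t) (fun t => psi t - psi' t).
Proof.
move=> u u' e e0; have e20 : 0 < e / 2 by rewrite divr_gt0.
have [dl dl0 hdl] := u _ e20; have [dl' dl'0 hdl'] := u' _ e20.
exists (Num.min dl dl'); first by rewrite lt_min dl0.
move=> s h s0 /andP[h0]; rewrite lt_min => /andP[hd hd'].
rewrite (_ : _ - _ = (phi (s + h) - phi s - h * psi s) -
  (phi' (s + h) - phi' s - h * psi' s)); last by ring.
apply: le_trans (ler_normB _ _) _; rewrite (splitr e) mulrDl.
by apply: lerD; [apply: hdl|apply: hdl']; rewrite ?h0.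
Qed.

Lemma udiffM phi psi phi' psi' C :
  (forall t, 0 <= t -> [/\ `|phi t| <= C, `|psi t| <= C, `|phi' t| <= C & `|psi' t| <= C]) ->
  udiff phi psi -> udiff phi' psi' ->
  udiff (fun t => phi t * phi' t) (fun t => psi t * phi' t + phi t * psi' t).
Proof.
move=> bC u u' e e0.
have C0 : 0 <= C by have [+ _ _ _] := bC 0 (lexx 0); apply: le_trans.
(* The error splits into two terms of size C e1 h and one of order h^2; [e1] makes each of the first
   two at most e h / 4 and [dl2] does so for the third. C + 1 keeps the divisors positive when C =
   0. *)
pose e1 := e / (4 * (C + 1)).
have e10 : 0 < e1 by rewrite divr_gt0// mulr_gt0// ltr_wpDl.
have [dl dl0 hdl] := u _ e10; have [dl' dl'0 hdl'] := u' _ e10.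
pose dl2 := e / (4 * (C + 1) * (C + e1)).
have dl20 : 0 < dl2 by rewrite divr_gt0// !mulr_gt0// ?ltr_wpDl// ltr_wpDl.
exists (Num.min dl2 (Num.min dl dl')); first by rewrite !lt_min dl0 dl20.
move=> s h s0 /andP[h0]; rewrite !lt_min => /and3P[hd2 hd hd'].
have [p1 p2 p3 p4] := bC s s0; have [_ _ p3' _] := bC (s + h) (addr_ge0 s0 (ltW h0)).
have E := hdl s h s0 (introT andP (conj h0 hd)).
have E' := hdl' s h s0 (introT andP (conj h0 hd')).
set a := phi (s + h) - phi s - h * psi s in E.
set b := phi' (s + h) - phi' s - h * psi' s in E'.
rewrite (_ : _ - _ = a * phi' (s + h) + phi s * b + (h * psi s) * (b + h * psi' s)); last first.
  by rewrite /a /b; ring.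
have n1 : `|a * phi' (s + h)| <= e1 * h * C by rewrite normrM ler_pM.
have n2 : `|phi s * b| <= C * (e1 * h) by rewrite normrM ler_pM.
have n3 : `|h * psi s * (b + h * psi' s)| <= h * C * (e1 * h + h * C).
  rewrite normrM ler_pM// ?normrM; first by rewrite (gtr0_norm h0) ler_wpM2l// ltW.
  apply: le_trans (ler_normD _ _) (lerD E' _).
  by rewrite normrM (gtr0_norm h0) ler_wpM2l// ltW.
have C1 : 0 < C + 1 by rewrite ltr_wpDl.
have k1 : e1 * C <= e / 4.
  rewrite /e1 -mulrA ler_wpM2l ?(ltW e0)// invfM -mulrA ler_piMr ?invr_ge0//.
  by rewrite mulrC ler_pdivrMr// mul1r lerDl.
have k2 : h * C * (e1 + C) <= e / 4.
  have := ltW hd2; rewrite /dl2 ler_pdivlMr; last by rewrite !mulr_gt0// ltr_wpDl.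
  move=> hh; rewrite ler_pdivlMr//; apply: le_trans hh.
  rewrite -!mulrA ler_wpM2l ?(ltW h0)//.
  rewrite [leLHS](_ : _ = C * (4 * (C + e1))); last by ring.
  rewrite [leRHS](_ : _ = (C + 1) * (4 * (C + e1))); last by ring.
  by rewrite ler_wpM2r ?lerDl// mulr_ge0// addr_ge0// ltW.
apply: le_trans (ler_normD _ _) _.
apply: le_trans (lerD (ler_normD _ _) (lexx _)) _.
apply: le_trans (lerD (lerD n1 n2) n3) _.
have {}k1 : e1 * C * h <= e / 4 * h by rewrite ler_wpM2r// ltW.
have {}k2 : h * C * (e1 + C) * h <= e / 4 * h by rewrite ler_wpM2r// ltW.
rewrite [leLHS](_ : _ = e1 * C * h + e1 * C * h + h * C * (e1 + C) * h); last by ring.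
apply: le_trans (lerD (lerD k1 k1) k2) _.
rewrite -!mulrDl ler_wpM2r ?(ltW h0)//.
by lra.
Qed.

(** By convexity the increment of x^(n+1) dominates h times its derivative at the left end; hence b
    x^(n+1) / (n+1) absorbs each grid step of slope at most b x^n. *)
Lemma exprD_ge (x h : R) n : 0 <= x -> 0 <= h ->
  n.+1%:R * h * x ^+ n <= (x + h) ^+ n.+1 - x ^+ n.+1.
Proof.
move=> x0 h0; elim: n => [|n ih].
  by rewrite expr0 !expr1 mulr1 mul1r addrC addKr.
rewrite [leRHS](_ : _ = (x + h) * ((x + h) ^+ n.+1 - x ^+ n.+1) + h * x ^+ n.+1).
  2: by rewrite !(exprS _ n.+1); ring.
rewrite -natr1 mulrDl mulrDl mul1r lerD2r.
apply: le_trans (_ : x * (n.+1%:R * h * x ^+ n) <= _).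
  by rewrite exprS mulrCA.
apply: ler_pM => //; last by rewrite lerDl.
by rewrite !mulr_ge0// exprn_ge0.
Qed.

Lemma udiff_growth phi psi b n : udiff phi psi -> phi 0 = 0 -> 0 <= b ->
  (forall t, 0 <= t -> `|psi t| <= b * t ^+ n) ->
  forall t, 0 <= t -> `|phi t| <= b / n.+1%:R * t ^+ n.+1.
Proof.
move=> u phi0 b0 psib t; rewrite le_eqVlt => /predU1P[<-|t0].
  by rewrite phi0 normr0 expr0n mulr0.
apply/ler_addgt0Pr => e e0.
(* Each grid step of length [h] may lose e h / t, which adds up to [e] over [0, t]. *)
have et0 : 0 < e / t by rewrite divr_gt0.
have [dl dl0 hdl] := u _ et0.
have [m tm] : exists m : nat, t / m.+1%:R < dl.
  have /= := @near_infty_natSinv_lt R (PosNum (divr_gt0 dl0 t0)).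
  case=> m _ /(_ m (leqnn m)) /= hm; exists m.
  by rewrite mulrC -ltr_pdivlMr.
set h := t / m.+1%:R in tm.
have h0 : 0 < h by rewrite divr_gt0.
have step i : `|phi (i%:R * h)| <= b / n.+1%:R * (i%:R * h) ^+ n.+1 + e / t * (i%:R * h).
  elim: i => [|i ih]; first by rewrite mul0r phi0 normr0 expr0n !mulr0 addr0.
  have ih0 : 0 <= i%:R * h by rewrite mulr_ge0// ltW.
  rewrite -natr1 mulrDl mul1r; set x := i%:R * h in ih ih0 *.
  have E := hdl x h ih0 (introT andP (conj h0 tm)).
  rewrite (_ : phi (x + h) = phi x + h * psi x + (phi (x + h) - phi x - h * psi x)); last by ring.
  apply: le_trans (ler_normD _ _) _.
  rewrite mulrDr addrA; apply: lerD => //.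
  apply: le_trans (ler_normD _ _) _.
  apply: le_trans (lerD ih (lexx _)) _; rewrite addrAC lerD2r -lerBrDl -mulrBr.
  rewrite normrM (gtr0_norm h0).
  apply: le_trans (_ : h * (b * x ^+ n) <= _); first by rewrite ler_wpM2l ?psib// ltW.
  rewrite [leLHS]mulrCA -[leRHS]mulrA ler_wpM2l// [leRHS]mulrC ler_pdivlMr//.
  by rewrite mulrC mulrA; apply: exprD_ge => //; exact: ltW.
have := step m.+1; rewrite (_ : m.+1%:R * h = t); last by rewrite mulrC divfK.
by rewrite divfK// gt_eqF.
Qed.

Variables (c : R) (q : nat).
Hypotheses (c0 : 0 <= c) (q0 : (0 < q)%N).

(** Unfolded: (2 c q)^n m (m + q) ... (m + (n - 1) q) / n!. Each differentiation brings q m sites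
    and a factor 2 c, and enlarges the support by q; integrating t^(n-1) brings 1 / n. *)
Fixpoint growth_coef n m : R :=
  if n is n'.+1 then 2 * c * q%:R * m%:R * growth_coef n' (m + q) / n%:R else 1.

Lemma growth_coef_ge0 n m : 0 <= growth_coef n m.
Proof. by elim: n m => //= n ih m; rewrite !mulr_ge0. Qed.

(** With m at most q p the i-th factor is at most q (p + i), and (p + 1) ... (p + n) / n! is a
    binomial coefficient: growth of the supports and factorial balance up to a geometric factor. *)
Lemma growth_coef_le n m p : (m <= q * p)%N ->
  growth_coef n m <= (2 * c * q%:R * q%:R) ^+ n * 'C(p + n, n)%:R.
Proof.
elim: n m p => [|n ih] m p mp; first by rewrite bin0 expr0 mulr1.
have cq0 : 0 <= 2 * c * q%:R by rewrite !mulr_ge0.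
rewrite [growth_coef _ _]/= ler_pdivrMr// exprS.
have /ih le1 : (m + q <= q * p.+1)%N by rewrite mulnS addnC leq_add2l.
apply: le_trans (_ : 2 * c * q%:R * (q%:R * p.+1%:R) *
   ((2 * c * q%:R * q%:R) ^+ n * 'C(p.+1 + n, n)%:R) <= _).
  apply: ler_pM; [by rewrite mulr_ge0|exact: growth_coef_ge0| |exact: le1].
  (* Rounding p up to p + 1 makes the recursion of the coefficients coincide with that of the
     binomials. *)
  rewrite ler_wpM2l// -natrM ler_nat; apply: leq_trans mp _.
  by rewrite leq_mul2l leqnSn orbT.
rewrite le_eqVlt; apply/orP; left; apply/eqP.
rewrite -[RHS]mulrA; have -> : 'C(p + n.+1, n.+1)%:R * n.+1%:R = p.+1%:R * 'C(p.+1 + n, n)%:R :> R.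
  rewrite -!natrM mulnC mul_bin_left addSnnS; congr (_ * _)%:R.
  by rewrite -addSnnS addnK.
set a := _ ^+ n; set b := 'C(_, _)%:R; by ring.
Qed.

Lemma exp2_small (K e : R) : 0 < e -> exists n : nat, K / 2 ^+ n <= e.
Proof.
move=> e0; pose n := Num.bound `|K / e|; exists n.
rewrite ler_pdivrMr ?exprn_gt0// mulrC -ler_pdivrMr//.
apply: le_trans (ler_norm _) (ltW (lt_le_trans (archi_boundP (normr_ge0 _)) _)).
by rewrite -natrX ler_nat ltnW// ltn_expl.
Qed.

Lemma bin_le_exp n m : ('C(n, m) <= 2 ^ n)%N.
Proof.
elim: n m => [|n ih] [|m] //; first by rewrite bin0 expn_gt0.
by rewrite binS expnS mul2n -addnn leq_add.
Qed.

(** The binomial C(m + n, n) costs at most 2^(m+n); a time short enough for a factor 4^-n wins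
    against it and leaves 2^m / 2^n. This fixes the threshold 1/4. *)
Lemma growth_coef_exp n m s : 0 <= s -> 2 * c * q%:R * q%:R * s <= 4^-1 ->
  growth_coef n m * s ^+ n <= 2 ^+ m / 2 ^+ n.
Proof.
move=> s0 cs.
have K0 : 0 <= 2 * c * q%:R * q%:R by rewrite !mulr_ge0.
have mq : (m <= q * m)%N by rewrite leq_pmull.
apply: le_trans (ler_wpM2r (exprn_ge0 n s0) (growth_coef_le n mq)) _.
rewrite mulrAC -exprMn.
apply: le_trans (_ : (4^-1) ^+ n * (2 ^ (m + n))%:R <= _).
  apply: ler_pM; rewrite ?exprn_ge0// ?mulr_ge0//; last by rewrite ler_nat bin_le_exp.
  by rewrite lerXn2r// ?nnegrE// mulr_ge0.
rewrite natrX exprD mulrCA -exprMn (_ : 4^-1 * 2 = 2^-1); last by field.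
by rewrite exprVn.
Qed.

(* The derivative of a member of the family is dominated by [q m] members of the
   same kind with [m] and [M] enlarged, so that iterating [n] times yields an
   [n]-th order Taylor remainder. *)
Lemma iterated_growth (I : Type) (phi : I -> R -> R)
    (good : nat -> nat -> R -> I -> Prop) :
  (forall n m M i (t : R), 0 <= t -> good n m M i -> `|phi i t| <= 2 * M) ->
  (forall n m M i, good n.+1 m M i -> phi i 0 = 0 /\
     exists2 psi, udiff (phi i) psi &
       forall b t : R, 0 <= t -> 0 <= b ->
         (forall j, good n (m + q)%N (2 * c * M) j -> `|phi j t| <= b) ->
         `|psi t| <= (q * m)%:R * b) ->
  forall n m M i (s : R), 0 <= s -> 2 * c * q%:R * q%:R * s <= 4^-1 ->
    good n m M i -> `|phi i s| <= 2 * M * (2 ^+ m / 2 ^+ n).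
Proof.
move=> H0 H1.
have G n : forall m M i, good n m M i -> forall t, 0 <= t ->
    `|phi i t| <= 2 * M * growth_coef n m * t ^+ n.
  elim: n => [|n ih] m M i gi t t0.
    by rewrite /= expr0 !mulr1; exact: H0 gi.
  have M0 : 0 <= M.
    by have := le_trans (normr_ge0 _) (H0 _ _ _ _ _ t0 gi); rewrite pmulr_rge0.
  have [phi0 [psi u hpsi]] := H1 _ _ _ _ gi.
  pose b := (q * m)%:R * (2 * (2 * c * M) * growth_coef n (m + q)).
  have b0' : 0 <= 2 * (2 * c * M) * growth_coef n (m + q).
    by rewrite !mulr_ge0// growth_coef_ge0.
  have := udiff_growth u phi0 (_ : 0 <= b) _ t0.
  move=> /(_ n); rewrite (_ : b / _ = 2 * M * growth_coef n.+1 m); last first.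
    by rewrite /b /= natrM -!mulrA; ring.
  apply; first by rewrite /b mulr_ge0.
  move=> r r0; rewrite /b -(mulrA (q * m)%:R); apply: hpsi => //; first by rewrite mulr_ge0// exprn_ge0.
  by move=> j /ih; apply.
move=> n m M i s s0 cs gi; apply: le_trans (G _ _ _ _ gi _ s0) _.
have M0 : 0 <= M.
  by have := le_trans (normr_ge0 _) (H0 _ _ _ _ _ s0 gi); rewrite pmulr_rge0.
by rewrite -mulrA ler_wpM2l ?mulr_ge0// growth_coef_exp.
Qed.

End growth.

(** * Locality of a short time step *)

Section semigroup.
Variables (R : realType) (X : ptopologicalType) (d : nat).
Local Notation V := 'rV[int]_d.
Local Notation S := (config V X).
Variable P : R -> R.-pker S ~> S.
Hypothesis semiP : markov_semigroup P.
Implicit Types (f g : S -> R) (s t : R) (x : S).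
Local Notation T := (semigroup_op P).

Lemma bdm_semigroup t M f : bdm M f -> bdm M (T t f).
Proof. exact: bdm_kernel. Qed.

Lemma semigroup0 M f x : bdm M f -> T 0 f x = f x.
Proof.
move=> bf; rewrite /semigroup_op.
rewrite (eq_measure_integral (\d_x)); last by move=> B mB _; exact: semiP.1.
rewrite integral_dirac//; first by rewrite diracT mul1e.
by apply/measurable_EFinP; case: bf.
Qed.

Lemma semigroupD s t M f x : 0 <= s -> 0 <= t -> bdm M f ->
  T (s + t) f x = T s (T t f) x.
Proof.
move=> s0 t0 bf; apply: (bint_mixture _ _ _ bf); rewrite ?prob_kernel//.
by move=> B mB; exact: semiP.2.
Qed.

Lemma semigroupB t M M' f g x : bdm M f -> bdm M' g ->
  T t (fun y => f y - g y) x = T t f x - T t g x.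
Proof. exact: bintB (pker_fin _ _) _ _ _ _. Qed.

Lemma semigroupZ t M a f x : bdm M f -> T t (fun y => a * f y) x = a * T t f x.
Proof. exact: bintZ (pker_fin _ _) _ _ _. Qed.

Lemma semigroup_norm t M f x : bdm M f -> `|T t f x| <= M.
Proof. by move=> /(bdm_semigroup t) []. Qed.

Lemma semigroup_sum t (J : Type) (r : seq J) (Q : pred J) (F : J -> S -> R) M x :
  (forall j, Q j -> bdm M (F j)) ->
  T t (fun y => \sum_(j <- r | Q j) F j y) x = \sum_(j <- r | Q j) T t (F j) x.
Proof. exact: bint_sum (pker_fin _ _) _ _ _ _ _. Qed.

(** The increment at time [s] is [T s] applied to the increment at time 0, and [T s] contracts the
    supremum norm, so the modulus at 0 serves for all [s]. *)
Lemma semigroup_udiff (G : (S -> R) -> S -> R) f M K x :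
  has_generator P G -> cylinder_fun f -> bdm M f -> bdm K (G f) ->
  udiff (fun t => T t f x) (fun t => T t (G f) x).
Proof.
move=> genP cf bf bG e e0.
have [dl /= dl0 hdl] := genP f cf e e0.
exists dl => // s h s0 /andP[h0 hd].
have {}hdl y : `|T h f y - f y - h * G f y| <= e * h.
  have /= := hdl h; rewrite sub0r normrN gtr0_norm// => /(_ hd h0 y) /ltW hh.
  rewrite (_ : _ - _ = h * (h^-1 * (T h f y - f y) - G f y)); last first.
    by rewrite mulrBr mulrA mulfV ?gt_eqF// mul1r.
  by rewrite normrM gtr0_norm// mulrC ler_pM2r.
rewrite (semigroupD _ s0 (ltW h0) bf).
have bT := bdm_semigroup h bf.
rewrite -(semigroupB s x bT bf) -(semigroupZ s _ x bG).
rewrite -(semigroupB s x (bdmB bT bf) (bdmZ h bG)).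
apply: semigroup_norm; split => // .
by case: (bdmB (bdmB bT bf) (bdmZ h bG)).
Qed.

End semigroup.

Lemma le_sum4 (R : realDomainType) (a b c d : R) :
  0 <= a -> 0 <= b -> 0 <= c -> 0 <= d ->
  [/\ a <= a + b + c + d, b <= a + b + c + d,
      c <= a + b + c + d & d <= a + b + c + d].
Proof. by move=> *; split; lra. Qed.

Section local_step.
Variables (R : realType) (X : ptopologicalType) (d : nat).
Local Notation V := 'rV[int]_d.
Local Notation S := (config V X).
Variable N : set V.
Hypothesis cX : @second_countable X.
Hypotheses (finN : finite_set N) (N0 : N 0) (symN : forall v, N v -> N (- v)).
Variable alpha : R.-fker (config N X) ~> (config N X).
Variable c : R.
Hypothesis alphac : forall x, (alpha x setT < c%:E)%E.
Implicit Types (D E : {fset V}) (v w u : V) (f g : S -> R) (s t : R) (x : S).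

Local Notation q := (#|` fset_set N|).
Local Notation G_ := (gen_site alpha).
Local Notation fat := (fat N).
Local Notation dil := (dil N).

Let q0 : (0 < q)%N. Proof. exact: card_nbhs_gt0. Qed.
Let c0 : 0 <= c. Proof. exact: c_ge0 alphac. Qed.

(** Hence the doubled radii: one dilation reaches the site [v] whose jump affects the function, a
    second one the sites that [gen_site] reads around [v]. *)
Lemma grow_sub n D v : v \in dil D ->
  (fat n.*2 (D `|` dil [fset v]) `<=` fat n.+1.*2 D)%fset.
Proof.
move=> vD; rewrite doubleS -addn2 -fat_add; apply: fatS => //.
rewrite fsubUset; apply/andP; split; first exact: (sub_fat finN N0 2).
by apply: dilS => //; rewrite fsub1set.
Qed.

Lemma grow_card D v : (#|` D `|` dil [fset v]|%fset <= #|` D| + q)%N.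
Proof.
apply: leq_trans (leq_card_fsetU _ _).1 _; rewrite leq_add2l.
by apply: leq_trans (card_dil _ _) _; rewrite cardfs1 muln1.
Qed.

Lemma card_dil_le D m : (#|` D| <= m)%N -> (size (dil D) <= q * m)%N.
Proof. by move=> Dm; apply: leq_trans (card_dil _ _) _; rewrite leq_mul2l Dm orbT. Qed.

Lemma norm_sum_seq (J : eqType) (r : seq J) (Q : pred J) (F : J -> R) n (b : R) :
  (size r <= n)%N -> 0 <= b -> (forall j, j \in r -> Q j -> `|F j| <= b) ->
  `|\sum_(j <- r | Q j) F j| <= n%:R * b.
Proof.
move=> rn b0 Fb; apply: le_trans (_ : (size r)%:R * b <= _); last first.
  by rewrite ler_wpM2r// ler_nat.
elim: r Fb {rn} => [|j r ih] Fb; first by rewrite big_nil normr0 mul0r.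
rewrite big_cons /= -natr1 mulrDl mul1r [leRHS]addrC.
have {}ih : `|\sum_(i <- r | Q i) F i| <= (size r)%:R * b.
  by apply: ih => i ir; apply: Fb; rewrite inE ir orbT.
have [Qj|_] := boolP (Q j); last by apply: le_trans ih _; rewrite lerDr.
apply: le_trans (ler_normD _ _) _; apply: lerD => //.
by apply: Fb => //; rewrite mem_head.
Qed.

Lemma big_fsetU_disjoint (D E : {fset V}) (Q : pred V) (F : V -> R) :
  [disjoint D & E]%fset ->
  \sum_(v <- (D `|` E)%fset | Q v) F v =
  \sum_(v <- D | Q v) F v + \sum_(v <- E | Q v) F v.
Proof.
move=> /fdisjointP DE; rewrite -big_cat; apply: perm_big.
apply: uniq_perm => [||v]; rewrite ?fset_uniq//.
  rewrite cat_uniq !fset_uniq /= andbT; apply/hasPn => v vE.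
  by apply/negP => /DE; rewrite vE.
by rewrite mem_cat inE.
Qed.

Section one_semigroup.
Variables (A : set V) (P : R -> R.-pker S ~> S).
Hypotheses (semiP : markov_semigroup P) (genP : has_generator P (gen alpha A)).
Local Notation T := (semigroup_op P).

Lemma site_udiff D E M f x : cyl D M f -> (dil D `<=` E)%fset ->
  udiff (fun t => T t f x) (fun t => \sum_(v <- E | v \in A) T t (G_ v f) x).
Proof.
move=> cf DE.
have bG v : bdm (2 * c * M) (G_ v f) by case: (cyl_gen_site cX finN alphac v cf).
have GE : gen alpha A f = fun y => \sum_(v <- E | v \in A) G_ v f y.
  by apply/funext => y; apply: (genE cX finN symN alphac) cf DE.
rewrite [X in udiff _ X](_ : _ = fun t => T t (gen alpha A f) x); last first.
  by apply/funext => t; rewrite GE (semigroup_sum _ _ _ _ (fun v _ => bG v)).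
apply: (semigroup_udiff semiP x genP (cyl_cylinder cf) cf.1).
by rewrite GE; exact: bdm_sum.
Qed.

(** The two configurations stay fixed and the family is indexed by [f] alone; the generator at a
    site of [dil D] gives again a function that cannot tell them apart, until the n double layers
    are used up. *)
Lemma localisation n m M f D x x' s : 0 <= s ->
  2 * c * q%:R * q%:R * s <= 4^-1 ->
  cyl D M f -> (#|` D| <= m)%N -> (forall v, v \in fat n.*2 D -> x v = x' v) ->
  `|T s f x - T s f x'| <= 2 * M * (2 ^+ m / 2 ^+ n).
Proof.
move=> s0 cs cf Dm xx'.
pose good n m M f := exists D, [/\ cyl D M f, (#|` D| <= m)%N &
  forall v, v \in fat n.*2 D -> x v = x' v].
apply: (@iterated_growth R c q c0 q0 _ (fun f t => T t f x - T t f x') good);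
  [ | |exact: s0|exact: cs|by exists D].
- move=> k l K g t t0 [E [cg _ _]].
  apply: le_trans (ler_normB _ _) _; rewrite mulr_natl mulr2n.
  by apply: lerD; exact: semigroup_norm cg.1.
- move=> k l K g [E [cg El xE]]; split.
    rewrite !(semigroup0 semiP _ cg.1); apply/eqP; rewrite subr_eq0; apply/eqP.
    by apply: cg.2 => v vD; apply: xE; apply: (fsubsetP (sub_fat finN N0 _ _)).
  exists (fun t => \sum_(v <- dil E | v \in A) (T t (G_ v g) x - T t (G_ v g) x')).
    under [X in udiff _ X]eq_fun do rewrite sumrB.
    by apply: udiffB; exact: site_udiff cg _.
  move=> b t t0 b0 hb; apply: norm_sum_seq (card_dil_le El) b0 _ => v vE _.
  apply: hb; exists (E `|` dil [fset v])%fset; split.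
  + exact: cyl_gen_site.
  + by apply: leq_trans (grow_card _ _) _; rewrite leq_add2r.
  + by move=> w wE; apply: xE; exact: (fsubsetP (grow_sub _ vE)).
Qed.

Lemma decorrelation n m M1 M2 f g D D' x s : 0 <= s ->
  2 * c * q%:R * q%:R * s <= 4^-1 ->
  cyl D M1 f -> cyl D' M2 g -> (#|` D| + #|` D'| <= m)%N ->
  [disjoint fat n.*2 D & fat n.*2 D']%fset ->
  `|T s (fun y => f y * g y) x - T s f x * T s g x| <=
    2 * (M1 * M2) * (2 ^+ m / 2 ^+ n).
Proof.
move=> s0 cs cf cg Dm DD'.
(* Only |D| + |D'| and M1 M2 are recorded: each term of the derivative changes one factor and leaves
   the other alone, so both quantities evolve as for a single function. *)
pose good n m M (fg : (S -> R) * (S -> R)) := exists D D' M1 M2,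
  [/\ cyl D M1 fg.1, cyl D' M2 fg.2, (#|` D| + #|` D'| <= m)%N, M1 * M2 = M &
     [disjoint fat n.*2 D & fat n.*2 D']%fset].
pose phi (fg : (S -> R) * (S -> R)) t :=
  T t (fun y => fg.1 y * fg.2 y) x - T t fg.1 x * T t fg.2 x.
apply: (@iterated_growth R c q c0 q0 _ phi good _ _ n m (M1 * M2) (f, g));
  [ | |exact: s0|exact: cs|by exists D, D', M1, M2].
- move=> k l M [f1 g1] t t0 [E [E' [K1 [K2 [/= cf1 cg1 _ <- _]]]]].
  apply: le_trans (ler_normB _ _) _; rewrite mulr_natl mulr2n; apply: lerD.
    exact: semigroup_norm (bdmM cf1.1 cg1.1).
  by rewrite normrM; apply: ler_pM => //; [exact: semigroup_norm cf1.1|exact: semigroup_norm cg1.1].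
- move: n m M1 M2 f g D D' {cs cf cg Dm DD' s0} => _ _ _ _ _ _ _ _.
  move=> n m M [f g] [D [D' [M1 [M2 [/= cf cg Dm <- DD']]]]].
  have dDD' : [disjoint dil D & dil D']%fset.
    have sub E : (dil E `<=` fat n.+1.*2 E)%fset by exact: (@fat_mono _ _ finN N0 1).
    exact: fdisjointWl (sub D) (fdisjointWr (sub D') DD').
  split; first by rewrite /phi !(semigroup0 semiP _ (bdmM cf.1 cg.1))
    (semigroup0 semiP _ cf.1) (semigroup0 semiP _ cg.1) subrr.
  have cGf v := cyl_gen_site cX finN alphac v cf.
  have cGg v := cyl_gen_site cX finN alphac v cg.
  have M10 := bdm_ge0 cf.1; have M20 := bdm_ge0 cg.1.
  exists (fun t => \sum_(v <- dil D | v \in A) phi (G_ v f, g) t +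
                   \sum_(v <- dil D' | v \in A) phi (f, G_ v g) t).
    pose Sf t := \sum_(v <- dil D | v \in A) T t (G_ v f) x.
    pose Sg t := \sum_(v <- dil D' | v \in A) T t (G_ v g) x.
    (* The product rule. A contributing site is near [D] or near [D'] but not both, and its
       generator acts on that factor alone; hence the derivative is a sum of covariances of the same
       shape. *)
    rewrite [X in udiff _ X](_ : _ = fun t =>
      \sum_(v <- (dil D `|` dil D')%fset | v \in A) T t (G_ v (fun y => f y * g y)) x -
      (Sf t * T t g x + T t f x * Sg t)).
      apply: udiffB.
        apply: site_udiff (cylM cf cg) _.
        apply/fsubsetP => v /dilP[]// w; rewrite inE => /orP[] wD Nvw.
          by rewrite inE; apply/orP; left; apply/dilP => //; exists w.
        by rewrite inE; apply/orP; right; apply/dilP => //; exists w.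
      have b1 t : `|Sf t| <= (size (dil D))%:R * (2 * c * M1).
        apply: norm_sum_seq => //; first by rewrite !mulr_ge0.
        by move=> v _ _; exact: semigroup_norm (cGf v).1.
      have b2 t : `|Sg t| <= (size (dil D'))%:R * (2 * c * M2).
        apply: norm_sum_seq => //; first by rewrite !mulr_ge0.
        by move=> v _ _; exact: semigroup_norm (cGg v).1.
      set B1 := (size (dil D))%:R * _ in b1; set B2 := (size (dil D'))%:R * _ in b2.
      have B10 : 0 <= B1 by exact: le_trans (b1 0).
      have B20 : 0 <= B2 by exact: le_trans (b2 0).
      apply: (@udiffM _ _ _ _ _ (M1 + M2 + B1 + B2)); [|exact: site_udiff cf _|exact: site_udiff cg _].
      move=> t t0; have e1 := semigroup_norm P t x cf.1; have e2 := semigroup_norm P t x cg.1.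
      have {}b1 := b1 t; have {}b2 := b2 t.
      have [h1 h2 h3 h4] := le_sum4 M10 M20 B10 B20.
      by split; [exact: le_trans h1|exact: le_trans h3|exact: le_trans h2|exact: le_trans h4].
    apply/funext => t; rewrite /phi /= !sumrB opprD addrACA; congr (_ + _); last first.
      by rewrite /Sf /Sg mulr_suml mulr_sumr.
    rewrite big_fsetU_disjoint//; congr (_ + _); rewrite big_seq_cond [RHS]big_seq_cond;
      apply: eq_bigr => v /andP[vD _]; congr (T t _ x); apply/funext => y; apply/esym.
      by apply: (gen_siteM cX finN symN alphac) cf cg _; exact: (fdisjointP dDD').
    have vD' : v \notin dil D by move: dDD'; rewrite fdisjoint_sym => /fdisjointP; exact.
    rewrite [RHS]mulrC -(gen_siteM cX finN symN alphac y cg cf vD').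
    by congr (G_ v _ y); apply/funext => z; rewrite mulrC.
  (* The q m terms allowed are shared between the two sums: q |D| for the jumps near [D], the rest
     for those near [D']. *)
  move=> b t t0 b0 hb; rewrite (_ : (q * m)%:R * b = (q * #|` D|)%:R * b + (q * (m - #|` D|))%:R * b); last first.
    rewrite -mulrDl -natrD -mulnDr subnKC//; apply: leq_trans Dm; exact: leq_addr.
  apply: le_trans (ler_normD _ _) _; apply: lerD.
    apply: norm_sum_seq (card_dil_le (leqnn _)) b0 _ => v vD _.
    apply: hb; exists (D `|` dil [fset v])%fset, D', (2 * c * M1), M2; split => //=.
    + by apply: leq_trans (leq_add (grow_card _ _) (leqnn _)) _; rewrite addnAC leq_add2r.
    + by rewrite !mulrA.
    + apply: fdisjointWl (grow_sub _ vD) (fdisjointWr _ DD').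
      exact: (sub_fat finN N0 2).
  apply: norm_sum_seq (card_dil_le _) b0 _; first by rewrite leq_subRL ?(leq_trans _ Dm)// leq_addr.
  move=> v vD _.
  apply: hb; exists D, (D' `|` dil [fset v])%fset, M1, (2 * c * M2); split => //=.
  + by apply: leq_trans (leq_add (leqnn _) (grow_card _ _)) _; rewrite addnA leq_add2r.
  + by rewrite mulrCA !mulrA.
  + apply: fdisjointWl _ (fdisjointWr (grow_sub _ vD) DD').
    exact: (sub_fat finN N0 2).
Qed.

End one_semigroup.

Section two_semigroups.
Variables (A A' : set V) (P P' : R -> R.-pker S ~> S).
Hypotheses (semiP : markov_semigroup P) (genP : has_generator P (gen alpha A)).
Hypotheses (semiP' : markov_semigroup P') (genP' : has_generator P' (gen alpha A')).
Local Notation T := (semigroup_op P).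
Local Notation T' := (semigroup_op P').

Lemma comparison n m M f D x s : 0 <= s ->
  2 * c * q%:R * q%:R * s <= 4^-1 ->
  cyl D M f -> (#|` D| <= m)%N ->
  (forall v, v \in fat n.*2 D -> A v /\ A' v) ->
  `|T s f x - T' s f x| <= 2 * M * (2 ^+ m / 2 ^+ n).
Proof.
move=> s0 cs cf Dm AA'.
pose good n m M f := exists D, [/\ cyl D M f, (#|` D| <= m)%N &
  forall v, v \in fat n.*2 D -> A v /\ A' v].
apply: (@iterated_growth R c q c0 q0 _ (fun f t => T t f x - T' t f x) good);
  [ | |exact: s0|exact: cs|by exists D].
- move=> k l K g t t0 [E [cg _ _]].
  apply: le_trans (ler_normB _ _) _; rewrite mulr_natl mulr2n.
  by apply: lerD; exact: semigroup_norm cg.1.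
- move=> k l K g [E [cg El xE]]; split.
    by rewrite (semigroup0 semiP _ cg.1) (semigroup0 semiP' _ cg.1) subrr.
  have sub : (dil E `<=` fat k.+1.*2 E)%fset by exact: (@fat_mono _ _ finN N0 1).
  exists (fun t => \sum_(v <- dil E | v \in A) (T t (G_ v g) x - T' t (G_ v g) x)).
    rewrite [X in udiff _ X](_ : _ = fun t => \sum_(v <- dil E | v \in A) T t (G_ v g) x -
        \sum_(v <- dil E | v \in A') T' t (G_ v g) x).
      by apply: udiffB; [exact: site_udiff semiP genP _ _ _ _ x cg _|
                         exact: site_udiff semiP' genP' _ _ _ _ x cg _].
    apply/funext => t; rewrite sumrB; congr (_ - _).
    (* Around the support all sites are active in both dynamics, so the two sums run over the same
       sites. *)
    rewrite big_seq_cond [RHS]big_seq_cond; apply: eq_bigl => v.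
    have [vE|//] := boolP (v \in dil E).
    by have [Av A'v] := xE v (fsubsetP sub v vE); rewrite !mem_set.
  move=> b t t0 b0 hb; apply: norm_sum_seq (card_dil_le El) b0 _ => v vE _.
  apply: hb; exists (E `|` dil [fset v])%fset; split.
  + exact: cyl_gen_site.
  + by apply: leq_trans (grow_card _ _) _; rewrite leq_add2r.
  + by move=> w wE; apply: xE; exact: (fsubsetP (grow_sub _ vE)).
Qed.

(** The dynamics for different active sets are related by their generators alone. Here no distance
    limits the iteration: [good] holds at every level [n], so the bound tends to 0 and the two sides
    agree, as in a uniqueness proof for the semigroup. *)
Lemma translation u M f D x s : 0 <= s ->
  2 * c * q%:R * q%:R * s <= 4^-1 ->
  (forall w, A' w <-> A (w + u)) -> cyl D M f ->
  T s (f \o translate u) x = T' s f (translate u x).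
Proof.
move=> s0 cs AA' cf.
pose good (n m : nat) M f := exists D, cyl D M f /\ (#|` D| <= m)%N.
pose phi f t := T t (f \o translate u) x - T' t f (translate u x).
suff H n : `|phi f s| <= 2 * M * (2 ^+ #|` D| / 2 ^+ n).
  apply/eqP; rewrite -subr_eq0 -normr_le0 -/(phi f s); apply/ler_addgt0Pr => e e0.
  rewrite add0r; have [n] := exp2_small (2 * M * 2 ^+ #|` D|) e0.
  by apply: le_trans; rewrite -mulrA; exact: H.
apply: (@iterated_growth R c q c0 q0 _ phi good); [ | |exact: s0|exact: cs|by exists D].
- move=> k l K g t t0 [E [cg _]].
  apply: le_trans (ler_normB _ _) _; rewrite mulr_natl mulr2n.
  apply: lerD; first exact: semigroup_norm (cyl_translate cX u cg).1.
  exact: semigroup_norm cg.1.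
- move=> k l K g [E [cg El]].
  have cgu := cyl_translate cX u cg; split.
    by rewrite /phi (semigroup0 semiP _ cgu.1) (semigroup0 semiP' _ cg.1) subrr.
  pose Eu := [fset (v + u)%R | v in dil E]%fset.
  exists (fun t => \sum_(v <- dil E | v \in A') phi (G_ v g) t).
    rewrite [X in udiff _ X](_ : _ = fun t =>
        \sum_(v <- Eu | v \in A) T t (G_ v (g \o translate u)) x -
        \sum_(v <- dil E | v \in A') T' t (G_ v g) (translate u x)).
      apply: udiffB; last exact: site_udiff semiP' genP' _ _ _ _ _ cg _.
      apply: site_udiff semiP genP _ _ _ _ _ cgu _.
      apply/fsubsetP => v /dilP[]// _ /imfsetP[w /= wE ->] Nvw.
      apply/imfsetP; exists (v - u); last by rewrite subrK.
      by apply/dilP => //; exists w; rewrite // -addrA -opprD [u + w]addrC.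
    apply/funext => t; rewrite [LHS]sumrB; apply: (congr1 (fun z : R => z - _)).
    rewrite big_mkcond [RHS]big_mkcond big_imfset /=; last by move=> v w _ _ /addIr.
    apply: eq_bigr => v _.
    have -> : (v + u \in A) = (v \in A').
      by apply/idP/idP; rewrite !inE => /AA'.
    case: (v \in A'); last by [].
    apply: (congr1 (fun h => T t h x)); apply/funext => y.
    by rewrite (gen_site_translate cX alphac _ _ _ cg.1) addrK.
  move=> b t t0 b0 hb; apply: norm_sum_seq (card_dil_le El) b0 _ => v vE _.
  apply: hb; exists (E `|` dil [fset v])%fset; split; first exact: cyl_gen_site.
  by apply: leq_trans (grow_card _ _) _; rewrite leq_add2r.
Qed.

End two_semigroups.

End local_step.

(** * Local families *)

Section local_families.
Variables (R : realType) (X : ptopologicalType) (d : nat).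
Local Notation V := 'rV[int]_d.
Local Notation S := (config V X).
Variable N : set V.
Hypothesis cX : @second_countable X.
Hypotheses (finN : finite_set N) (N0 : N 0) (symN : forall v, N v -> N (- v)).
Implicit Types (D E : {fset V}) (v w u : V) (f g : S -> R) (x : S) (A : set V).
Implicit Types (T : set V -> (S -> R) -> S -> R) (e : R).
Local Notation q := (#|` fset_set N|).
Local Notation fat := (fat N).

Definition admissible A := fin_nonempty A \/ A = [set: V].

(* [T A] is a time step of the dynamics run with active sites [A]; the range [n]
   depends neither on [A] nor on the position of the supports. *)
Record local_family T : Prop := LocalFamily {
  lf_bdm : forall A, admissible A -> forall f, bdm 1 f -> bdm 1 (T A f);
  lf_nonexp : forall A, admissible A -> forall f g e, bdm 1 f -> bdm 1 g ->
    (forall x, `|f x - g x| <= e) -> forall x, `|T A f x - T A g x| <= e;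
  lf_loc : forall m e, 0 < e -> exists n, forall A, admissible A ->
    forall D f, cyl D 1 f -> (#|` D| <= m)%N ->
    exists2 f', cyl (fat n D) 1 f' & forall x, `|T A f x - f' x| <= e;
  lf_cmp : forall m e, 0 < e -> exists n, forall A, admissible A ->
    forall D f, cyl D 1 f -> (#|` D| <= m)%N ->
    (forall v, v \in fat n D -> A v) ->
    forall x, `|T A f x - T setT f x| <= e;
  lf_dec : forall m e, 0 < e -> exists n, forall A, admissible A ->
    forall D D' f g, cyl D 1 f -> cyl D' 1 g ->
    (#|` D| <= m)%N -> (#|` D'| <= m)%N ->
    [disjoint fat n D & fat n D']%fset ->
    forall x, `|T A (fun y => f y * g y) x - T A f x * T A g x| <= e;
  lf_tr : forall u A A', fin_nonempty A -> fin_nonempty A' ->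
    (forall w, A' w <-> A (w + u)) -> forall D f, cyl D 1 f ->
    forall x, T A (f \o translate u) x = T A' f (translate u x) }.

Lemma bdm1M f g : bdm 1 f -> bdm 1 g -> bdm 1 (fun x => f x * g x).
Proof. by move=> bf bg; rewrite -[1]mulr1; exact: bdmM. Qed.

Lemma dist_mul1 (a b a' b' e : R) : `|a| <= 1 -> `|b'| <= 1 ->
  `|a - a'| <= e -> `|b - b'| <= e -> `|a * b - a' * b'| <= e + e.
Proof.
move=> a1 b1 aa bb.
rewrite (_ : _ - _ = a * (b - b') + (a - a') * b'); last by ring.
apply: le_trans (ler_normD _ _) _; rewrite !normrM; apply: lerD.
  by rewrite -[e]mul1r; apply: ler_pM.
by rewrite -[e]mulr1; apply: ler_pM.
Qed.

Lemma local_family_id : local_family (fun _ f => f).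
Proof.
split => //.
- move=> m e e0; exists 0%N => A _ D f cf _; exists f => // x.
  by rewrite subrr normr0 ltW.
- by move=> m e e0; exists 0%N => A _ D f _ _ _ x; rewrite subrr normr0 ltW.
- by move=> m e e0; exists 0%N => A _ D D' f g _ _ _ _ _ x; rewrite subrr normr0 ltW.
Qed.

Let cardq n D m : (#|` D| <= m)%N -> (#|` fat n D| <= q ^ n * m)%N.
Proof. by move=> Dm; apply: leq_trans (card_fat _ _ _) _; rewrite leq_mul2l Dm orbT. Qed.

Let admT : admissible [set: V]. Proof. by right. Qed.

(** [T2 A f] is no longer a cylinder function. It is replaced, at a small cost that [T1] does not
    increase, by one living on [fat n2 D], whose cardinality is at most q^n2 m; so the range of the
    composite still depends only on [m] and [e]. *)
Lemma local_family_comp T1 T2 : local_family T1 -> local_family T2 ->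
  local_family (fun A f => T1 A (T2 A f)).
Proof.
move=> L1 L2; split.
- by move=> A aA f bf; apply: (lf_bdm L1) => //; exact: (lf_bdm L2).
- move=> A aA f g e bf bg fg; apply: (lf_nonexp L1) => //; try exact: (lf_bdm L2).
  exact: (lf_nonexp L2).
- move=> m e e0; have e20 : 0 < e / 2 by rewrite divr_gt0.
  have [n2 H2] := lf_loc L2 m e20; have [n1 H1] := lf_loc L1 (q ^ n2 * m)%N e20.
  exists (n1 + n2)%N => A aA D f cf Dm.
  have [f2 cf2 f2e] := H2 A aA D f cf Dm.
  have [f1 cf1 f1e] := H1 A aA _ f2 cf2 (cardq n2 Dm).
  exists f1; first by rewrite -fat_add.
  move=> x; rewrite -(subrKA (T1 A f2 x)) (splitr e).
  apply: le_trans (ler_normD _ _) _; apply: lerD => //.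
  by apply: (lf_nonexp L1) => //; [exact: (lf_bdm L2 aA cf.1)|exact: cf2.1].
(* Four exchanges at cost e / 4 each: the active set of [T2], the local substitute, the active set
   of [T1], and the substitute undone. *)
- move=> m e e0; have e40 : 0 < e / 4 by rewrite divr_gt0.
  have [n2 H2] := lf_loc L2 m e40; have [n3 H3] := lf_cmp L2 m e40.
  have [n1 H1] := lf_cmp L1 (q ^ n2 * m)%N e40.
  exists (n1 + n2 + n3)%N => A aA D f cf Dm hD x.
  have [f' cf' f'e] := H2 _ admT D f cf Dm.
  have b2 B aB := lf_bdm L2 (A := B) aB cf.1.
  have k1 : `|T1 A (T2 A f) x - T1 A (T2 setT f) x| <= e / 4.
    apply: (lf_nonexp L1) => //; try exact: b2.
    apply: (H3 A aA D f cf Dm) => v vD; apply: hD.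
    by apply: (fsubsetP (fat_mono finN N0 _ _)) vD; rewrite leq_addl.
  have k2 : `|T1 A (T2 setT f) x - T1 A f' x| <= e / 4.
    by apply: (lf_nonexp L1) => //; [exact: b2|exact: cf'.1].
  have k3 : `|T1 A f' x - T1 setT f' x| <= e / 4.
    apply: (H1 A aA _ f' cf' (cardq n2 Dm)) => v vD; apply: hD; move: vD; rewrite fat_add.
    by apply: (fsubsetP (fat_mono finN N0 _ _)); rewrite leq_addr.
  have k4 : `|T1 setT f' x - T1 setT (T2 setT f) x| <= e / 4.
    apply: (lf_nonexp L1) => //; [exact: cf'.1|exact: b2|].
    by move=> y; rewrite distrC.
  rewrite -(subrKA (T1 A (T2 setT f) x)) -(subrKA (T1 A f' x) (T1 A (T2 setT f) x)).
  rewrite -(subrKA (T1 setT f' x) (T1 A f' x)).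
  rewrite (_ : e = e / 4 + (e / 4 + (e / 4 + e / 4))); last by field.
  apply: le_trans (ler_normD _ _) _; apply: lerD => //.
  apply: le_trans (ler_normD _ _) _; apply: lerD => //.
  by apply: le_trans (ler_normD _ _) _; apply: lerD.
(* Six errors: one for decorrelation in each of [T1] and [T2], and two for each of the two exchanges
   between a product and its local substitute. *)
- move=> m e e0; pose e' := e / 6; have e'0 : 0 < e' by rewrite divr_gt0.
  have [n2 H2] := lf_loc L2 m e'0; have [n3 H3] := lf_dec L2 m e'0.
  have [n1 H1] := lf_dec L1 (q ^ n2 * m)%N e'0.
  exists (n1 + n2 + n3)%N => A aA D D' f g cf cg Dm D'm DD' x.
  have [f' cf' f'e] := H2 A aA D f cf Dm.
  have [g' cg' g'e] := H2 A aA D' g cg D'm.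
  have bf2 := lf_bdm L2 aA cf.1; have bg2 := lf_bdm L2 aA cg.1.
  have disj n : (n <= n1 + n2 + n3)%N -> [disjoint fat n D & fat n D']%fset.
    by move=> nn; apply: fdisjointWl (fdisjointWr _ DD'); exact: fat_mono.
  have k1 : `|T1 A (T2 A (fun y => f y * g y)) x -
              T1 A (fun y => T2 A f y * T2 A g y) x| <= e'.
    apply: (lf_nonexp L1) => //; [|exact: bdm1M|].
      by apply: (lf_bdm L2) => //; exact: bdm1M cf.1 cg.1.
    by move=> y; apply: (H3 A aA D D') => //; apply: disj; rewrite leq_addl.
  have k2 : `|T1 A (fun y => T2 A f y * T2 A g y) x -
              T1 A (fun y => f' y * g' y) x| <= e' + e'.
    apply: (lf_nonexp L1) => //; [exact: bdm1M|exact: bdm1M cf'.1 cg'.1|].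
    by move=> y; apply: dist_mul1 => //; [case: bf2|case: cg'.1].
  have k3 : `|T1 A (fun y => f' y * g' y) x - T1 A f' x * T1 A g' x| <= e'.
    apply: (H1 A aA _ _ f' g' cf' cg' (cardq _ Dm) (cardq _ D'm)).
    by rewrite !fat_add; apply: disj; rewrite leq_addr.
  have k4 : `|T1 A f' x * T1 A g' x - T1 A (T2 A f) x * T1 A (T2 A g) x| <= e' + e'.
    apply: dist_mul1.
    - by case: (lf_bdm L1 aA cf'.1).
    - by case: (lf_bdm L1 aA bg2).
    - apply: (lf_nonexp L1) => //; first exact: cf'.1.
      by move=> y; rewrite distrC.
    - apply: (lf_nonexp L1) => //; first exact: cg'.1.
      by move=> y; rewrite distrC.
  rewrite -(subrKA (T1 A (fun y => T2 A f y * T2 A g y) x)).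
  rewrite -(subrKA (T1 A (fun y => f' y * g' y) x) (T1 A (fun y => T2 A f y * T2 A g y) x)).
  rewrite -(subrKA (T1 A f' x * T1 A g' x) (T1 A (fun y => f' y * g' y) x)).
  rewrite (_ : e = e' + ((e' + e') + (e' + (e' + e')))); last by rewrite /e'; field.
  apply: le_trans (ler_normD _ _) _; apply: lerD => //.
  apply: le_trans (ler_normD _ _) _; apply: lerD => //.
  by apply: le_trans (ler_normD _ _) _; apply: lerD.
- move=> u A A' finA finA' AA' D f cf x.
  have aA : admissible A by left. have aA' : admissible A' by left.
  have cfu := cyl_translate cX u cf.
  have E : T2 A (f \o translate u) = T2 A' f \o translate u.
    by apply/funext => y; exact: lf_tr L2 u A A' finA finA' AA' D f cf y.
  have bE : bdm 1 (T2 A' f \o translate u).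
    by rewrite -E; exact: lf_bdm L2 A aA _ cfu.1.
  (* [lf_tr] speaks of cylinder functions and [T2 A' f] is only a uniform limit of such; equality is
     reached up to every e > 0. *)
  rewrite E; apply/eqP; rewrite -subr_eq0 -normr_le0; apply/ler_addgt0Pr => e e0.
  rewrite add0r; have e20 : 0 < e / 2 by rewrite divr_gt0.
  have [n H] := lf_loc L2 #|` D| e20.
  have [f' cf' f'e] := H A' aA' D f cf (leqnn _).
  rewrite -(subrKA (T1 A (f' \o translate u) x)) (splitr e).
  apply: le_trans (ler_normD _ _) _; apply: lerD.
    apply: (lf_nonexp L1) => //; first exact: (cyl_translate cX u cf').1.
    by move=> y; exact: f'e.
  rewrite (lf_tr L1 finA finA' AA' cf').
  apply: (lf_nonexp L1) => //; [exact: cf'.1|exact: (lf_bdm L2 aA' cf.1)|].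
  by move=> y; rewrite distrC.
Qed.

Lemma local_family_iter T k : local_family T ->
  local_family (fun A => iter k (T A)).
Proof.
move=> LT; elim: k => [|k ih]; first exact: local_family_id.
exact: (local_family_comp LT ih).
Qed.

(** Composition with [freeze D] makes any function depend on the sites of [D] alone; [localisation]
    bounds the resulting error. *)
Definition freeze D (x : S) : S := fun v => if v \in D then x v else point.

Lemma measurable_freeze D : measurable_fun setT (freeze D).
Proof.
apply: (measurable_into_S cX) => v; rewrite /freeze; case: (v \in D) => //.
exact: measurable_site.
Qed.

Variable alpha : R.-fker (config N X) ~> (config N X).
Variable c : R.
Hypothesis alphac : forall z, (alpha z setT < c%:E)%E.
Variable P : set V -> R -> R.-pker S ~> S.
Hypothesis semiP : forall A, admissible A -> markov_semigroup (P A).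
Hypothesis genP : forall A, admissible A -> has_generator (P A) (gen alpha A).
Variable s : R.
Hypotheses (s0 : 0 <= s) (cs : 2 * c * q%:R * q%:R * s <= 4^-1).

Lemma local_family_semigroup : local_family (fun A => semigroup_op (P A) s).
Proof.
split.
- by move=> A _ f; exact: bdm_semigroup.
- move=> A _ f g e bf bg fg x; rewrite -(semigroupB (P A) s x bf bg).
  apply: semigroup_norm; split => //.
  by case: (bdmB bf bg).
- move=> m e e0; have [n Hn] := exp2_small (2 * 1 * 2 ^+ m) e0.
  exists n.*2 => A aA D f cf Dm.
  exists (semigroup_op (P A) s f \o freeze (fat n.*2 D)).
    split; last first.
      move=> x y xy; congr (semigroup_op _ _ _ _); apply/funext => v.
      by rewrite /freeze; case: ifP => // /xy.
    have [mT bT] := bdm_semigroup (P A) s cf.1.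
    by split => [|x]; [exact: measurableT_comp mT (measurable_freeze _)|exact: bT].
  move=> x; apply: le_trans Hn; rewrite -mulrA.
  apply: (localisation cX finN N0 symN alphac (semiP aA) (genP aA) s0 cs cf Dm).
  by move=> v; rewrite /freeze => ->.
- move=> m e e0; have [n Hn] := exp2_small (2 * 1 * 2 ^+ m) e0.
  exists n.*2 => A aA D f cf Dm hD x; apply: le_trans Hn; rewrite -mulrA.
  apply: (comparison cX finN N0 symN alphac (semiP aA) (genP aA) (semiP admT)
    (genP admT) x s0 cs cf Dm).
  by move=> v /hD.
- move=> m e e0; have [n Hn] := exp2_small (2 * (1 * 1) * 2 ^+ (m + m)) e0.
  exists n.*2 => A aA D D' f g cf cg Dm D'm DD' x; apply: le_trans Hn; rewrite -mulrA.
  exact: (decorrelation cX finN N0 symN alphac (semiP aA) (genP aA) x s0 cs cf cg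
    (leq_add Dm D'm) DD').
- move=> u A A' finA finA' AA' D f cf x.
  have aA : admissible A by left. have aA' : admissible A' by left.
  exact: (translation cX finN N0 symN alphac (semiP aA) (genP aA) (semiP aA')
    (genP aA') x s0 cs AA' cf).
Qed.

End local_families.

(** * The initial law *)

Section image_measure.
Context {R : realType} {d1 d2} {T1 : measurableType d1} {T2 : measurableType d2}.
Variables (mu : {measure set T1 -> \bar R}) (phi : T1 -> T2).
Hypothesis mphi : measurable_fun setT phi.

Definition image_measure : {measure set T2 -> \bar R} :=
  measure_function_pushforward__canonical__measure_function_Measure mu mphi.

Lemma bint_image M (h : T2 -> R) : (mu setT < +oo)%E -> bdm M h ->
  \int[image_measure]_y h y = \int[mu]_x h (phi x).
Proof.
move=> fmu bh; rewrite /Rintegral; congr fine.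
rewrite integral_pushforward//; first by apply/measurable_EFinP; case: bh.
apply: (bdm_integrable fmu (M := M)).
by case: bh => mh hM; split => [|x]; [exact: measurableT_comp|exact: hM].
Qed.

Lemma integrable_image (f : T2 -> \bar R) :
  image_measure.-integrable setT f -> mu.-integrable setT (f \o phi).
Proof.
move=> /integrableP[mf intf]; apply/integrableP.
split; first exact: (measurableT_comp mf mphi).
by move: intf; rewrite ge0_integral_pushforward//; exact: measurableT_comp.
Qed.

End image_measure.

Section initial_law.
Variables (R : realType) (X : ptopologicalType) (d : nat).
Local Notation V := 'rV[int]_d.
Local Notation S := (config V X).
Hypothesis cX : @second_countable X.
Implicit Types (D E J : {fset V}) (v w u : V) (f g : S -> R) (x : S).

Variables (nu : probability (borel X) R) (mu : probability S R).
Hypothesis mu_box : forall J (B : V -> set (borel X)), (forall v, measurable (B v)) ->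
  mu [set x | forall v, v \in J -> B v (x v)] = (\prod_(v <- J) nu (B v))%E.

Lemma box_measurable J (B : V -> set (borel X)) : (forall v, measurable (B v)) ->
  measurable [set x : S | forall v, v \in J -> B v (x v)].
Proof.
move=> mB; rewrite (_ : [set _ | _] = \bigcap_(v in [set` J]) [set x | B v (x v)]) //.
apply: fin_bigcap_measurable => [|v _]; first exact: finite_fset.
by have := measurable_site cX v measurableT (mB v); rewrite setTI.
Qed.

Let mu1 : mu [set: S] = 1%E. Proof. exact: probability_setT. Qed.

Let fmu : (mu setT < +oo)%E. Proof. by rewrite probability_setT ltry. Qed.

Lemma law_unique (m : {measure set S -> \bar R}) M f :
  (forall J (B : V -> set (borel X)), (forall v, measurable (B v)) ->
     m [set x | forall v, v \in J -> B v (x v)] = (\prod_(v <- J) nu (B v))%E) ->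
  bdm M f -> \int[m]_x f x = \int[mu]_x f x.
Proof.
move=> mbox bf; rewrite /Rintegral; congr fine.
apply: eq_measure_integral => E mE _; apply/esym.
apply: (eq_on_boxes (countV _) cX fmu) => // J B mB.
by apply: etrans (mu_box J mB) _; apply: esym; exact: mbox.
Qed.

Lemma law_translate u M f : bdm M f ->
  \int[mu]_x f (translate u x) = \int[mu]_x f x.
Proof.
move=> bf; rewrite -(bint_image (measurable_translate cX u) fmu bf).
apply: law_unique bf => J B mB.
pose Ju := [fset (v + u)%R | v in J]%fset.
rewrite /image_measure /= /pushforward [X in mu X](_ : _ = [set x : S | forall v, v \in Ju -> B (v - u) (x v)]).
  rewrite (mu_box _ (fun v => mB (v - u))) big_imfset /=; last by move=> v w _ _ /addIr.
  by apply: eq_bigr => v _; rewrite addrK.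
apply/seteqP; split => x /= h v.
  by move=> /imfsetP[w /= wJ ->]; rewrite addrK; exact: h.
by move=> vJ; rewrite -{1}(addrK u v); apply: h; apply/imfsetP; exists v.
Qed.

Definition splice D (p : S * S) : S := fun v => if v \in D then p.1 v else p.2 v.

Lemma measurable_splice D : measurable_fun setT (splice D).
Proof.
apply: (measurable_into_S cX) => v; rewrite /splice; case: (v \in D).
  exact: (measurableT_comp (measurable_site cX v) measurable_fst).
exact: (measurableT_comp (measurable_site cX v) measurable_snd).
Qed.

Let fmm : ((mu \x mu)%E setT < +oo)%E.
Proof.
suff -> : (mu \x mu)%E setT = (1 * 1)%E by rewrite mul1e ltry.
rewrite -setXTT; apply: etrans (product_measure1E _ _ _ _) _ => //.
by congr (_ * _)%E; exact: mu1.
Qed.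

(** Drawing the sites of [D] from one sample and the others from an independent copy does not change
    a product law, as each box probability splits along [D]. *)
Lemma law_splice D M f : bdm M f ->
  \int[(mu \x mu)%E]_p f (splice D p) = \int[mu]_x f x.
Proof.
move=> bf.
rewrite -(bint_image (measurable_splice D) fmm bf).
apply: law_unique bf => J B mB.
pose J1 := [fset v in J | v \in D]%fset; pose J2 := [fset v in J | v \notin D]%fset.
pose box (E : {fset V}) := [set x : S | forall v, v \in E -> B v (x v)].
transitivity ((mu \x mu)%E (box J1 `*` box J2)); last first.
  rewrite product_measure1E; [|exact: box_measurable..].
  rewrite [RHS](big_fsetID _ (fun v => v \in D)).
  by congr (_ * _)%E; exact: mu_box.
congr ((mu \x mu)%E _).
apply/seteqP; split => -[x y] /=; rewrite /splice /=.
  by move=> h; split => v; rewrite !inE /= => /andP[vJ vD]; have := h v vJ; rewrite ?vD// (negbTE vD).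
move=> [h1 h2] v vJ; case: ifP => vD; first by apply: h1; rewrite !inE /= vJ vD.
by apply: h2; rewrite !inE /= vJ vD.
Qed.

(** Spliced along [D], [f] sees only the first copy and [g] only the second, and Fubini factors the
    integral. *)
Lemma law_independent D D' M M' f g : cyl D M f -> cyl D' M' g ->
  [disjoint D & D']%fset ->
  \int[mu]_x (f x * g x) = (\int[mu]_x f x) * (\int[mu]_x g x).
Proof.
move=> cf cg DD'; have bfg := bdmM cf.1 cg.1.
rewrite -(law_splice D bfg).
have E p : f (splice D p) * g (splice D p) = f p.1 * g p.2.
  congr (_ * _); first by apply: cf.2 => v vD; rewrite /splice vD.
  apply: cg.2 => v vD'; rewrite /splice; case: ifP => // vD.
  by have := fdisjointP DD' v vD; rewrite vD'.
have bF : bdm (M * M') (fun p : S * S => f p.1 * g p.2).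
  apply: bdmM.
    by case: cf.1 => mf fM; split => [|p]; [exact: (measurableT_comp mf measurable_fst)|exact: fM].
  by case: cg.1 => mg gM; split => [|p]; [exact: (measurableT_comp mg measurable_snd)|exact: gM].
under eq_Rintegral do rewrite E.
rewrite /Rintegral -integral12_prod_meas1; last exact: (bdm_integrable fmm bF).
rewrite -[fine (\int[mu]_x (f x)%:E)]/(\int[mu]_x f x).
rewrite -(bintZr fmu _ cf.1) /Rintegral; congr fine; apply: eq_integral => x _.
rewrite /fubini_F /=.
rewrite -[LHS]fineK; last first.
  apply: integrable_fin_num => //; exact: (bdm_integrable fmu (bdmZ (f x) cg.1)).
by congr EFin; exact: (bintZ fmu (f x) cg.1).
Qed.

Variable N : set V.
Hypotheses (finN : finite_set N) (N0 : N 0).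

(** Integration against the initial law, read as a step with constant output: composed with the
    dynamics it carries the initial randomness through the same calculus. Exact independence allows
    range 0. *)
Lemma local_family_law : local_family N (fun _ f _ => \int[mu]_x f x).
Proof.
have b1 f : bdm 1 f -> `|\int[mu]_x f x| <= 1.
  by move=> bf; apply: (bint_norm1 fmu) => //; exact: mu1.
have bc f : bdm 1 f -> bdm 1 (fun _ : S => \int[mu]_x f x).
  by move=> bf; split => // _; exact: b1.
split.
- by move=> A _ f; exact: bc.
- move=> A _ f g e bf bg fg _; rewrite -(bintB fmu bf bg).
  apply: (bint_norm1 fmu); first exact: mu1.
  by split => //; case: (bdmB bf bg).
- move=> m e e0; exists 0%N => A _ D f cf _; exists (fun _ => \int[mu]_x f x).
    by split => //; exact: bc cf.1.
  by move=> x; rewrite subrr normr0 ltW.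
- by move=> m e e0; exists 0%N => A _ D f _ _ _ x; rewrite subrr normr0 ltW.
- move=> m e e0; exists 0%N => A _ D D' f g cf cg _ _ DD' x.
  by rewrite (law_independent cf cg DD') subrr normr0 ltW.
- by move=> u A A' _ _ _ D f cf x; exact: law_translate cf.1.
Qed.

End initial_law.

(** * Weak law of large numbers *)

Section law_of_large_numbers.
Variables (R : realType) (X : ptopologicalType) (d : nat).
Local Notation V := 'rV[int]_d.
Local Notation S := (config V X).
Variable N : set V.
Hypothesis cX : @second_countable X.
Hypotheses (finN : finite_set N) (N0 : N 0) (symN : forall v, N v -> N (- v)).
Implicit Types (B D E : {fset V}) (v w u : V) (f g : S -> R) (x : S) (A : set V).
Implicit Types (e : R).
Local Notation q := (#|` fset_set N|).
Local Notation fat := (fat N).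
Local Notation dil := (dil N).
Local Notation "\theta_ v" := (@translate X d v) (at level 8).

Lemma finite_ext_boundary A : finite_set A -> finite_set (ext_boundary N A).
Proof.
move=> finA; apply: (@sub_finite_set _ _ [set` dil (fset_set A)]); last exact: finite_fset.
move=> z [[v Av [w Nw <-]] _] /=; apply/dilP => //.
by exists v; rewrite ?in_fset_set ?inE// addrC addKr.
Qed.

(** On a chain of N-steps from [v] to a site outside [A], the first site outside lies in the
    external boundary; symmetry of [N] turns this around, placing [v] close to the boundary. *)
Lemma shallow n A v : finite_set A -> A v ->
  ~ (forall z, z \in fat n [fset v]%fset -> A z) ->
  v \in fat n (fset_set (ext_boundary N A)).
Proof.
move=> finA Av nA.
suff [z zv bz] : exists2 z, z \in fat n [fset v]%fset & ext_boundary N A z.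
  have := zv; rewrite (fat1_sym finN symN) => vz.
  apply: (fsubsetP (fatS finN n _)) vz; rewrite fsub1set in_fset_set ?inE//.
  exact: finite_ext_boundary.
have [z zv Az] : exists2 z, z \in fat n [fset v]%fset & ~ A z.
  by apply: contrapT => h; apply: nA => z zv; apply: contrapT => Az; apply: h; exists z.
elim: n z zv Az {nA} => [|n ih] z zv Az.
  by move: zv Az; rewrite /= inE => /eqP ->.
have /dilP[//|w wv Nzw] := zv.
have [Aw|nAw] := pselect (A w).
  exists z => //; split => //; exists w => //; exists (z - w) => //.
  by rewrite addrC subrK.
have [z' z'v bz'] := ih w wv nAw.
by exists z' => //; apply: (fsubsetP (sub_dil finN N0 _)).
Qed.

Lemma fat_translate n z v : z \in fat n [fset 0]%fset -> z + v \in fat n [fset v]%fset.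
Proof.
elim: n z => [|n ih] z /=; first by rewrite !inE => /eqP ->; rewrite add0r.
move=> /dilP[//|w wz Nzw]; apply/dilP => //; exists (w + v); first exact: ih.
by rewrite opprD addrACA subrr addr0.
Qed.

Lemma fin_nonempty_translate A v : fin_nonempty A -> fin_nonempty [set w | A (w + v)].
Proof.
move=> [finA [a Aa]]; split; last by exists (a - v); rewrite /= subrK.
apply: (@sub_finite_set _ _ [set w - v | w in A]); last exact: finite_image.
by move=> w /= Aw; exists (w + v); rewrite ?addrK.
Qed.

Variable m : set V -> {measure set S -> \bar R}.
Hypothesis m1 : forall A, admissible A -> m A setT = 1%E.
Variable L : set V -> (S -> R) -> S -> R.
Hypothesis LF : local_family N L.
Hypothesis Lm : forall A, admissible A -> forall f, bdm 1 f ->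
  forall x, L A f x = \int[m A]_y f y.

Let fm A : admissible A -> (m A setT < +oo)%E.
Proof. by move=> aA; rewrite m1// ltry. Qed.

Let admT : @admissible d setT. Proof. by right. Qed.

(** Site [v] under the dynamics on [A] is the origin under the dynamics on A - v. As [L] outputs
    constants, it may be evaluated at any configuration. *)
Lemma mean_translate A v D f : fin_nonempty A -> cyl D 1 f ->
  \int[m A]_x f (\theta_v x) = \int[m [set w | A (w + v)]]_x f x.
Proof.
move=> finA cf; pose A' := [set w | A (w + v)].
have finA' : fin_nonempty A' by exact: fin_nonempty_translate.
have aA : admissible A by left. have aA' : admissible A' by left.
have bfv := (cyl_translate cX v cf).1.
rewrite -(Lm aA bfv point) -(Lm aA' cf.1 (\theta_v point)).
exact: (lf_tr LF finA finA' (fun w => iff_refl _) cf).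
Qed.

Variable F : S -> R.
Hypothesis cF : cyl (fat 1 [fset 0])%fset 1 F.
Local Notation EF := (\int[m setT]_x F x).
Local Notation F_ v := (fun x => F (\theta_v x)).

Let cF_ v : cyl (fat 1 [fset v])%fset 1 (F_ v).
Proof.
apply: cyl_sub (cyl_translate cX v cF); apply/fsubsetP => z /imfsetP[w /= w0 ->].
exact: (fat_translate (n := 1)).
Qed.

Let bc v : bdm 2 (fun x => F_ v x - EF).
Proof.
have bE : `|EF| <= 1 by exact: (bint_norm1 (fm admT) (m1 admT) cF.1).
have [mF _] := bdmB (cF_ v).1 (bdm_cst EF).
split => // x; apply: le_trans (ler_normB _ _) _.
by rewrite (_ : 2 = 1 + 1)//; apply: lerD => //; exact: (cF_ v).1.2.
Qed.

Lemma pair_covariance e : 0 < e -> exists n, forall A, fin_nonempty A ->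
  forall v u, (forall z, z \in fat n [fset v]%fset -> A z) ->
              (forall z, z \in fat n [fset u]%fset -> A z) ->
              [disjoint fat n [fset v] & fat n [fset u]]%fset ->
  `|\int[m A]_x ((F_ v x - EF) * (F_ u x - EF))| <= 3 * e.
Proof.
move=> e0; have [n1 H1] := lf_cmp LF q e0; have [n2 H2] := lf_dec LF q e0.
have card1 v : (#|` fat 1 [fset v]%fset| <= q)%N.
  by apply: leq_trans (card_fat _ _ _) _; rewrite cardfs1 expn1 muln1.
(* The extra layer accounts for the support [fat 1] of [F]; [n1] serves the means and [n2] the
   decorrelation. *)
exists (n1 + n2 + 1)%N => A finA v u hv hu disj.
have aA : admissible A by left.
have mean w : (forall z, z \in fat (n1 + n2 + 1) [fset w]%fset -> A z) ->
    `|\int[m A]_x F_ w x - EF| <= e.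
  move=> hw; rewrite (mean_translate w finA cF).
  pose A' := [set z | A (z + w)].
  have aA' : admissible A' by left; exact: fin_nonempty_translate.
  rewrite -(Lm aA' cF.1 point) -(Lm admT cF.1 point).
  apply: (H1 A' aA' _ F cF (card1 0)) => z zD; apply: hw; apply: fat_translate.
  move: zD; rewrite fat_add; apply: (fsubsetP (fat_mono finN N0 _ _)).
  by rewrite leq_add2r leq_addr.
have dec : `|\int[m A]_x (F_ v x * F_ u x) - (\int[m A]_x F_ v x) * (\int[m A]_x F_ u x)| <= e.
  have bvu : bdm 1 (fun x => F_ v x * F_ u x) by exact: bdm1M (cF_ v).1 (cF_ u).1.
  rewrite -(Lm aA bvu point) -(Lm aA (cF_ v).1 point) -(Lm aA (cF_ u).1 point).
  apply: (H2 A aA _ _ _ _ (cF_ v) (cF_ u) (card1 v) (card1 u)).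
  have sub w : (fat n2 (fat 1 [fset w]) `<=` fat (n1 + n2 + 1) [fset w])%fset.
    by rewrite fat_add; apply: (fat_mono finN N0); rewrite leq_add2r leq_addl.
  exact: fdisjointWl (sub v) (fdisjointWr (sub u) disj).
have {mean hv hu disj H1 H2} [ev eu] := (mean v hv, mean u hu).
have fA := fm aA; have bu := (cF_ u).1; have bv := (cF_ v).1.
have bE : `|EF| <= 1 by exact: (bint_norm1 (fm admT) (m1 admT) cF.1).
have Iu : `|\int[m A]_x F_ u x| <= 1 by exact: (bint_norm1 fA (m1 aA) bu).
(* Centring is at the limit mean [EF]: this leaves a covariance, worth e, plus the product of two
   biases, one at most e and the other at most 2. *)
have -> : \int[m A]_x ((F_ v x - EF) * (F_ u x - EF)) =
    \int[m A]_x (F_ v x * F_ u x) - (\int[m A]_x F_ v x) * (\int[m A]_x F_ u x) +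
    (\int[m A]_x F_ v x - EF) * (\int[m A]_x F_ u x - EF).
  have E1 : \int[m A]_x ((F_ v x - EF) * (F_ u x - EF)) =
      \int[m A]_x ((F_ v x * F_ u x - EF * F_ u x) - (EF * F_ v x - EF * EF)).
    by apply: eq_Rintegral => x _; ring.
  rewrite E1 (bintB fA (bdmB (bdmM bv bu) (bdmZ _ bu)) (bdmB (bdmZ _ bv) (bdm_cst _))).
  rewrite (bintB fA (bdmM bv bu) (bdmZ _ bu)) (bintB fA (bdmZ _ bv) (bdm_cst _)).
  rewrite (bintZ fA _ bu) (bintZ fA _ bv) Rintegral_cst// (m1 aA) mulr1.
  by ring.
apply: le_trans (ler_normD _ _) _.
rewrite (_ : 3 * e = e + e * 2); last by ring.
apply: lerD => //; rewrite normrM; apply: ler_pM => //.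
apply: le_trans (ler_normB _ _) _; rewrite (_ : 2 = 1 + 1)//; exact: lerD.
Qed.

Definition average B x : R := #|` B|%:R^-1 * \sum_(v <- B) F_ v x.

Lemma bdm_average B : bdm 1 (average B).
Proof.
have [/eqP|B0] := boolP (B == fset0).
  move=> ->; rewrite /average; under eq_fun do rewrite big_seq_fset0 mulr0.
  by split => // x; rewrite normr0.
have Bgt0 : 0 < #|` B|%:R :> R by rewrite ltr0n cardfs_gt0.
have := bdmZ (#|` B|%:R^-1 : R) (bdm_sum (enum_fset B) (fun v _ => (cF_ v).1) (P := xpredT)).
by rewrite count_predT mulr1 ger0_norm ?invr_ge0 ?ltW// mulVf ?gt_eqF.
Qed.

Lemma sum_indic_le (B E : {fset V}) : \sum_(v <- B) (v \in E)%:R <= #|` E|%:R :> R.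
Proof.
rewrite -natr_sum ler_nat.
rewrite (eq_bigr (fun v => if v \in E then 1 else 0)%N); last by move=> v _; case: (v \in E).
rewrite -big_mkcond sum1_count -size_filter.
apply: uniq_leq_size; first by rewrite filter_uniq// fset_uniq.
by move=> v; rewrite mem_filter => /andP[].
Qed.

Lemma variance_bound e : 0 < e -> exists K : R, 0 <= K /\ forall A, fin_nonempty A ->
  \int[m A]_x (average (fset_set A) x - EF) ^+ 2 <= 3 * e +
    K * ((cardf (ext_boundary N A))%:R / (cardf A)%:R + (cardf A)%:R^-1).
Proof.
move=> e0; have [n Hn] := pair_covariance e0.
(* A centred product is at most 4. In an exceptional pair one of the two members is within [n]
   layers of the boundary, with at most q^n sites per boundary site, or the members are close, with
   at most q^(2n) choices for given v. *)
exists (8 * (q ^ n)%:R + 4 * (q ^ (n + n))%:R); split => [|A finA].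
  by rewrite addr_ge0// mulr_ge0.
have aA : admissible A by left.
have fA := fm aA; have [fsA [a Aa]] := finA.
pose B := fset_set A; have inB v : (v \in B) = (v \in A) by rewrite in_fset_set.
pose b : R := #|` B|%:R.
have b0 : 0 < b.
  by rewrite ltr0n cardfs_gt0; apply/fset0Pn; exists a; rewrite inB inE.
pose bad := fat n (fset_set (ext_boundary N A)).
pose near v := fat (n + n) [fset v]%fset.
pose C v u := \int[m A]_x ((F_ v x - EF) * (F_ u x - EF)).
have C4 v u : `|C v u| <= 4.
  apply: (bint_norm1 fA (m1 aA)); rewrite (_ : 4 = 2 * 2); last by ring.
  exact: bdmM.
have Cvu v u : v \in B -> u \in B ->
    C v u <= 3 * e + 4 * (v \in bad)%:R + 4 * (u \in bad)%:R + 4 * (u \in near v)%:R.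
  rewrite !inB !inE => Av Au.
  have p4 (k : bool) : 0 <= 4 * k%:R :> R by rewrite mulr_ge0.
  have e30 : 0 <= 3 * e by rewrite mulr_ge0// ltW.
  have leC : C v u <= 4 by apply: le_trans (ler_norm _) (C4 v u).
  have [_ h1 h2 h3] := le_sum4 e30 (p4 (v \in bad)) (p4 (u \in bad)) (p4 (u \in near v)).
  have [vb|vb] := boolP (v \in bad).
    by move: h1; rewrite vb mulr1 => h1; exact: le_trans leC h1.
  have [ub|ub] := boolP (u \in bad).
    by move: h2; rewrite (negbTE vb) ub mulr1 => h2; exact: le_trans leC h2.
  have [un|un] := boolP (u \in near v).
    by move: h3; rewrite (negbTE vb) (negbTE ub) un mulr1 => h3; exact: le_trans leC h3.
  rewrite !mulr0 !addr0; apply: le_trans (ler_norm _) (Hn A finA v u _ _ _).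
  - by apply: contrapT => /(shallow fsA Av); rewrite (negbTE vb).
  - by apply: contrapT => /(shallow fsA Au); rewrite (negbTE ub).
  - by rewrite -(fat_disjoint finN symN) fat_add fdisjointX1.
have -> : \int[m A]_x (average B x - EF) ^+ 2 =
    b ^- 2 * \sum_(v <- B) \sum_(u <- B) C v u.
  transitivity (\int[m A]_x (b ^- 2 * \sum_(v <- B) \sum_(u <- B)
      (F_ v x - EF) * (F_ u x - EF))).
    apply: eq_Rintegral => x _.
    rewrite (_ : average B x - EF = b^-1 * \sum_(v <- B) (F_ v x - EF)).
      rewrite exprMn exprVn; congr (_ * _); rewrite expr2 mulr_suml.
      by apply: eq_bigr => v _; rewrite mulr_sumr.
    rewrite sumrB mulrBr /average -/b; congr (_ - _).
    by rewrite big_const_seq count_predT iter_addr_0 -mulr_natl mulrA mulVf ?mul1r ?gt_eqF.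
  have bs v : bdm ((count xpredT B)%:R * (2 * 2))
     (fun x => \sum_(u <- B) (F_ v x - EF) * (F_ u x - EF)).
    by apply: bdm_sum => u _; exact: bdmM.
  rewrite (bintZ fA _ (bdm_sum _ (fun v _ => bs v) (P := xpredT))); congr (_ * _).
  rewrite (bint_sum fA _ (fun v _ => bs v)); apply: eq_bigr => v _.
  exact: (bint_sum fA _ (fun u _ => bdmM (bc v) (bc u))).
have S1 : \sum_(v <- B) \sum_(u <- B) C v u <=
    3 * e * b ^+ 2 + 8 * #|` bad|%:R * b + 4 * (q ^ (n + n))%:R * b.
  apply: le_trans (_ : \sum_(v <- B) \sum_(u <- B) (3 * e + 4 * (v \in bad)%:R +
      4 * (u \in bad)%:R + 4 * (u \in near v)%:R) <= _).
    by rewrite big_seq [leRHS]big_seq; apply: ler_sum => v vB;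
      rewrite big_seq [leRHS]big_seq; apply: ler_sum => u uB; exact: Cvu.
  have sc (a0 : R) : \sum_(u <- B) a0 = a0 * b.
    by rewrite big_const_seq count_predT iter_addr_0 mulr_natr.
  have nearle v : \sum_(u <- B) (u \in near v)%:R <= (q ^ (n + n))%:R :> R.
    apply: le_trans (sum_indic_le _ _) _; rewrite ler_nat.
    by apply: leq_trans (card_fat _ _ _) _; rewrite cardfs1 muln1.
  have badle : \sum_(u <- B) (u \in bad)%:R <= #|` bad|%:R :> R by exact: sum_indic_le.
  apply: le_trans (_ : \sum_(v <- B) (3 * e * b + 4 * (v \in bad)%:R * b +
      4 * #|` bad|%:R + 4 * (q ^ (n + n))%:R) <= _).
    apply: ler_sum => v _; rewrite !big_split /= !sc -!mulr_sumr.
    by apply: lerD; [apply: lerD => //|]; rewrite ler_wpM2l.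
  rewrite !big_split /= !sc -mulr_suml -mulr_sumr expr2.
  have : 4 * (\sum_(v <- B) (v \in bad)%:R) * b <= 4 * #|` bad|%:R * b.
    by apply: ler_wpM2r; [exact: ltW|exact: ler_wpM2l].
  set t := \sum_(v <- B) _; set r := #|` bad|%:R; set k := (q ^ _)%:R => h.
  rewrite -subr_ge0 (_ : _ - _ = 4 * r * b - 4 * t * b); last by ring.
  by rewrite subr_ge0.
have badN : #|` bad|%:R <= (q ^ n)%:R * (cardf (ext_boundary N A))%:R :> R.
  by rewrite -natrM ler_nat; exact: card_fat.
apply: le_trans (ler_wpM2l _ S1) _; first by rewrite invr_ge0 exprn_ge0// ltW.
rewrite [cardf A]/(#|` B|) -/b; set bd := (cardf _)%:R : R in badN *.
have bd0 : 0 <= bd by [].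
rewrite (_ : b ^- 2 * _ = 3 * e + 8 * #|` bad|%:R / b + 4 * (q ^ (n + n))%:R / b); last first.
  by field; rewrite gt_eqF.
rewrite -addrA lerD2l.
apply: le_trans (_ : 8 * ((q ^ n)%:R * bd) / b + 4 * (q ^ (n + n))%:R / b <= _).
  rewrite lerD2r; apply: ler_wpM2r; first by rewrite invr_ge0 ltW.
  exact: ler_wpM2l.
set k1 := (q ^ n)%:R : R; set k2 := (q ^ (n + n))%:R : R.
have k10 : 0 <= k1 by []. have k20 : 0 <= k2 by [].
have ib : 0 <= b^-1 by rewrite invr_ge0 ltW.
rewrite -subr_ge0 (_ : _ - _ = 8 * k1 * b^-1 + 4 * k2 * (bd * b^-1)); last by ring.
by rewrite addr_ge0// !mulr_ge0.
Qed.

Lemma weak_law e : 0 < e -> exists2 dl : R, 0 < dl & forall A, fin_nonempty A ->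
  (cardf (ext_boundary N A))%:R / (cardf A)%:R <= dl -> (cardf A)%:R^-1 <= dl ->
  \int[m A]_x `|average (fset_set A) x - EF| <= e.
Proof.
(* The constants: 3 e1 = e^2 / 8, and [dl] makes the boundary terms at most e^2 / 8 too, so the
   second moment is at most e^2 / 4 and the mean deviation at most e / 2 + e / 8. *)
move=> e0; pose e1 := e ^+ 2 / 24.
have e10 : 0 < e1 by rewrite divr_gt0// exprn_gt0.
have [K [K0 HK]] := variance_bound e10.
exists (e ^+ 2 / (16 * (K + 1))).
  by rewrite divr_gt0 ?exprn_gt0// mulr_gt0// ltr_wpDl.
move=> A finA h1 h2; have aA : admissible A by left.
have fA := fm aA.
have bE : `|EF| <= 1 by exact: (bint_norm1 (fm admT) (m1 admT) cF.1).
have bW : bdm (1 + `|EF|) (fun x => average (fset_set A) x - EF).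
  exact: bdmB (bdm_average _) (bdm_cst _).
have bW2 : bdm ((1 + `|EF|) * (1 + `|EF|)) (fun x => (average (fset_set A) x - EF) ^+ 2).
  exact: (bdmM bW bW).
have bW1 : bdm (1 + `|EF|) (fun x => `|average (fset_set A) x - EF|).
  by case: bW => mW W1; split => [|x]; [exact: measurableT_comp|rewrite normr_id].
(* AM-GM: [|w| <= e / 2 + w ^ 2 / (2 e)] *)
apply: le_trans (_ : \int[m A]_x (e / 2 + (2 * e)^-1 * (average (fset_set A) x - EF) ^+ 2) <= _).
  apply: (bint_le fA bW1 (bdmD (bdm_cst (e / 2)) (bdmZ _ bW2))) => x.
  set w := _ - EF; rewrite -subr_ge0.
  rewrite (_ : _ - _ = (2 * e)^-1 * (e - `|w|) ^+ 2).
    by rewrite mulr_ge0 ?sqr_ge0// invr_ge0 mulr_ge0// ltW.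
  by rewrite -(real_normK (num_real w)); field; rewrite gt_eqF.
rewrite (bintD fA (bdm_cst _) (bdmZ _ bW2)) (bintZ fA _ bW2) Rintegral_cst// (m1 aA) mulr1.
have V1 := HK A finA.
have V2 : K * ((cardf (ext_boundary N A))%:R / (cardf A)%:R + (cardf A)%:R^-1) <= e ^+ 2 / 8.
  apply: le_trans (ler_wpM2l K0 (lerD h1 h2)) _.
  rewrite (_ : K * _ = e ^+ 2 / 8 * (K / (K + 1))); last by field; rewrite gt_eqF// ltr_wpDl.
  rewrite ler_piMr ?divr_ge0 ?sqr_ge0//.
  by rewrite ler_pdivrMr ?mul1r ?lerDl// ltr_wpDl.
have V3 : \int[m A]_x (average (fset_set A) x - EF) ^+ 2 <= e ^+ 2 / 4.
  apply: le_trans V1 _; apply: le_trans (lerD (lexx _) V2) _.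
  by rewrite /e1; lra.
apply: le_trans (lerD (lexx _) (ler_wpM2l _ V3)) _; first by rewrite invr_ge0 mulr_ge0// ltW.
rewrite (_ : e / 2 + _ = e * (5 / 8)); last by field; rewrite gt_eqF.
by rewrite ler_piMr ?ltW//; lra.
Qed.

End law_of_large_numbers.

(** * Truncation *)

Section truncation.
Context {R : realType} {d} {T : measurableType d}.
Variable mu : {measure set T -> \bar R}.
Hypothesis mu1 : mu setT = 1%E.
Implicit Types (h g : T -> R) (K M gamma : R).

Let fmu : (mu setT < +oo)%E. Proof. by rewrite mu1 ltry. Qed.

Definition trunc K h x : R := if `|h x| <= K then h x else 0.

Lemma trunc_norm K h x : 0 <= K -> `|trunc K h x| <= K.
Proof. by move=> K0; rewrite /trunc; case: ifP => // _; rewrite normr0. Qed.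

Lemma trunc_bdm K h : 0 <= K -> measurable_fun setT h -> bdm K (trunc K h).
Proof.
move=> K0 mh; split => [|x]; last exact: trunc_norm.
apply: measurable_fun_ifT => //.
by apply: measurable_fun_ler => //; exact: measurableT_comp.
Qed.

Lemma bdm_EFin M h : bdm M h -> (\int[mu]_x (h x)%:E)%E = (\int[mu]_x h x)%:E.
Proof.
move=> bh; rewrite /Rintegral fineK//.
exact: integrable_fin_num (bdm_integrable fmu bh).
Qed.

(** Truncations of a non-negative function increase with the level, so monotone convergence applies.
    Moment bounds thus follow from bounded functions, the only ones on which the dynamics are
    controlled. *)
Lemma trunc_moment_bound M h : measurable_fun setT h -> (forall x, 0 <= h x) ->
  (forall n : nat, \int[mu]_x trunc n%:R h x <= M) ->
  (\int[mu]_x (h x)%:E <= M%:E)%E.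
Proof.
move=> mh h0 hM.
have nd x : {homo (fun n : nat => (trunc n%:R h x)%:E) : a b / (a <= b)%N >-> (a <= b)%E}.
  move=> a b ab; rewrite lee_fin /trunc; case: ifPn => [ha|_].
    by rewrite ifT//; apply: le_trans ha _; rewrite ler_nat.
  by case: ifP.
have bt n : bdm n%:R (trunc n%:R h) by exact: trunc_bdm.
have t0 n x : 0 <= trunc n%:R h x by rewrite /trunc; case: ifP.
have -> : (\int[mu]_x (h x)%:E = \int[mu]_x limn (fun n => (trunc n%:R h x)%:E))%E.
  apply: eq_integral => x _; apply/esym/cvg_lim => //.
  apply: cvg_near_cst; near=> n; rewrite /trunc ifT// ger0_norm//.
  near: n; exists (Num.bound (h x)) => // n /= hn.
  apply: le_trans (ltW (archi_boundP (h0 x))) _; by rewrite ler_nat.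
rewrite monotone_convergence//; last 2 first.
- by move=> n; apply/measurable_EFinP; case: (bt n).
- by move=> n x _; rewrite lee_fin.
apply: lime_le; last by apply: nearW => n; rewrite (bdm_EFin (bt n)) lee_fin.
apply: ereal_nondecreasing_is_cvgn => a b ab; apply: ge0_le_integral => //.
- by move=> x _; rewrite lee_fin.
- by apply/measurable_EFinP; case: (bt a).
- by apply/measurable_EFinP; case: (bt b).
- by move=> x _; exact: nd.
Unshelve. all: by end_near. Qed.

Lemma trunc_moment_le M h K : 0 <= K -> measurable_fun setT h -> (forall x, 0 <= h x) ->
  (\int[mu]_x (h x)%:E <= M%:E)%E -> \int[mu]_x trunc K h x <= M.
Proof.
move=> K0 mh h0; have bt := trunc_bdm K0 mh.
rewrite -lee_fin -(bdm_EFin bt); apply: le_trans; apply: ge0_le_integral => //.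
- by move=> x _; rewrite lee_fin /trunc; case: ifP.
- by apply/measurable_EFinP; case: bt.
- exact/measurable_EFinP.
- by move=> x _; rewrite lee_fin /trunc; case: ifP.
Qed.

Lemma measurable_powR_norm gamma h : measurable_fun setT h ->
  measurable_fun setT (fun x => `|h x| `^ gamma).
Proof.
move=> mh; apply: (measurableT_comp (measurable_powR gamma)).
exact: measurableT_comp.
Qed.

(** Where |h| exceeds K, the factor (|h| / K)^(gamma - 1) is at least 1. *)
Lemma trunc_tail gamma K h x : 1 < gamma -> 0 < K ->
  `|h x - trunc K h x| <= (K `^ (gamma - 1))^-1 * `|h x| `^ gamma.
Proof.
move=> g1 K0; have kp : 0 < K `^ (gamma - 1) by exact: powR_gt0.
rewrite /trunc; case: ifPn => [_|].
  by rewrite subrr normr0 mulr_ge0 ?powR_ge0// invr_ge0 ltW.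
rewrite -ltNge subr0 => Kh; rewrite mulrC ler_pdivlMr//.
have h0 : 0 < `|h x| by exact: lt_trans Kh.
rewrite [X in _ <= X](_ : _ = `|h x| * `|h x| `^ (gamma - 1)).
  apply: ler_wpM2l => //; apply: ge0_ler_powR; rewrite ?nnegrE ?subr_ge0 ?ltW//.
rewrite -{2}(powRr1 (ltW h0)) -powRD; first by congr (_ `^ _); ring.
by rewrite (gt_eqF h0) implybT.
Qed.

(** From |h| <= 1 + |h|^gamma and the unit mass of [mu]. *)
Lemma moment_integrable gamma M h : 1 < gamma -> measurable_fun setT h ->
  (\int[mu]_x (`|h x| `^ gamma)%:E <= M%:E)%E -> mu.-integrable setT (EFin \o h).
Proof.
move=> g1 mh hM; apply/integrableP; split; first exact/measurable_EFinP.
apply: le_lt_trans (_ : (\int[mu]_x ((1 : R)%:E + (`|h x| `^ gamma)%:E) < +oo)%E).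
  apply: ge0_le_integral => //.
  - by apply/measurable_EFinP; exact: measurableT_comp.
  - by apply: emeasurable_funD => //; apply/measurable_EFinP; exact: measurable_powR_norm.
  - move=> x _ /=; rewrite -EFinD lee_fin.
    have [h1|h1] := leP `|h x| 1; first by apply: le_trans h1 _; rewrite lerDl powR_ge0.
    by apply: ler_wpDl => //; rewrite -{1}(powRr1 (normr_ge0 _)); apply: ler_powR; exact: ltW.
rewrite ge0_integralD//; last by apply/measurable_EFinP; exact: measurable_powR_norm.
rewrite integral_cst// mu1 mule1.
by apply: le_lt_trans (leeD2l _ hM) _; rewrite -EFinD ltry.
Qed.

End truncation.

(** * The weak law under a uniform moment bound *)

Section weak_law_moment.
Variables (R : realType) (X : ptopologicalType) (d : nat).
Local Notation V := 'rV[int]_d.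
Local Notation S := (config V X).
Variable N : set V.
Hypothesis cX : @second_countable X.
Hypotheses (finN : finite_set N) (N0 : N 0) (symN : forall v, N v -> N (- v)).
Implicit Types (B D E : {fset V}) (v w u : V) (f g : S -> R) (x : S) (A : set V).
Implicit Types (e : R).
Local Notation fat := (fat N).
Variable m : set V -> {measure set S -> \bar R}.
Hypothesis m1 : forall A, admissible A -> m A setT = 1%E.
Variable L : set V -> (S -> R) -> S -> R.
Hypothesis LF : local_family N L.
Hypothesis Lm : forall A, admissible A -> forall f, bdm 1 f ->
  forall x, L A f x = \int[m A]_y f y.

Let fm A : admissible A -> (m A setT < +oo)%E.
Proof. by move=> aA; rewrite m1// ltry. Qed.

Let admT : @admissible d setT. Proof. by right. Qed.

Variables (gamma M : R) (h : S -> R).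
Hypothesis gamma1 : 1 < gamma.
Hypothesis mh : measurable_fun setT h.
Hypothesis hD : forall x y, (forall v, v \in fat 1 [fset 0]%fset -> x v = y v) -> h x = h y.
Hypothesis hM : forall A, fin_nonempty A ->
  (\int[m A]_x (`|h x| `^ gamma)%:E <= M%:E)%E.

Let g0 x : R := `|h x| `^ gamma.

Let mg0 : measurable_fun setT g0. Proof. exact: measurable_powR_norm. Qed.

Let g0_ge0 x : 0 <= g0 x. Proof. exact: powR_ge0. Qed.

(** Local families handle functions bounded by 1; dividing by K + 1 rather than K covers K = 0. *)
Let cyl_rescale K f : 0 <= K -> bdm K f ->
  (forall x y, (forall v, v \in fat 1 [fset 0]%fset -> x v = y v) -> f x = f y) ->
  cyl (fat 1 [fset 0]%fset) 1 (fun x => (K + 1)^-1 * f x).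
Proof.
move=> K0 [mf fK] fD; have K1 : 0 < K + 1 by rewrite ltr_wpDl.
split; last by move=> x y xy; congr (_ * _); exact: fD.
split; first exact: measurable_funM.
move=> x; rewrite normrM ger0_norm ?invr_ge0 ?(ltW K1)// mulrC ler_pdivrMr// mul1r.
by apply: le_trans (fK x) _; rewrite lerDl.
Qed.

Let cylg n : cyl (fat 1 [fset 0]%fset) 1 (fun x => (n%:R + 1)^-1 * trunc n%:R g0 x).
Proof.
apply: cyl_rescale => //; first exact: trunc_bdm.
by move=> x y xy; rewrite /trunc /g0 (hD xy).
Qed.

(** The moment hypothesis concerns the origin but all finite active sets, and site [v] under [A] is
    the origin under A - v. Truncation brings |h|^gamma within reach of [mean_translate]. *)
Lemma moment_translate A v : fin_nonempty A ->
  (\int[m A]_x (`|h (translate v x)| `^ gamma)%:E <= M%:E)%E.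
Proof.
move=> finA; have aA : admissible A by left.
pose A' := [set w | A (w + v)].
have finA' : fin_nonempty A' by exact: fin_nonempty_translate.
have aA' : admissible A' by left.
apply: (trunc_moment_bound (h := g0 \o translate v) (m1 aA)) => [|x|n].
- exact: measurableT_comp mg0 (measurable_translate cX v).
- exact: g0_ge0.
have bt : bdm n%:R (trunc n%:R g0) by exact: trunc_bdm.
have btv : bdm n%:R (fun x => trunc n%:R g0 (translate v x)).
  case: bt => mt tn; split => [|x]; last exact: tn.
  exact: measurableT_comp mt (measurable_translate cX v).
have n1 : 0 < n%:R + 1 :> R by rewrite ltr_wpDl.
have := mean_translate cX LF Lm v finA (cylg n).
rewrite (bintZ (fm aA) _ btv) (bintZ (fm aA') _ bt).
move=> /(mulfI (invr_neq0 (lt0r_neq0 n1))) ->.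
by apply: (trunc_moment_le (m1 aA')) => //; exact: hM.
Qed.

(** Each truncated moment of the infinite dynamics is approximated by those for large finite active
    sets, all at most [M]. *)
Lemma moment_limit : (\int[m setT]_x (`|h x| `^ gamma)%:E <= M%:E)%E.
Proof.
apply: (trunc_moment_bound (h := g0) (m1 admT)) => // n.
have bt : bdm n%:R (trunc n%:R g0) by exact: trunc_bdm.
have n1 : 0 < n%:R + 1 :> R by rewrite ltr_wpDl.
apply/ler_addgt0Pr => e e0.
have en : 0 < (n%:R + 1)^-1 * e by rewrite mulr_gt0// invr_gt0.
have [k Hk] := lf_cmp LF #|` fat 1 [fset 0]%fset| en.
(* The smallest set for which [lf_cmp] applies: its side condition becomes the identity. *)
pose A := [set` fat k (fat 1 [fset 0]%fset)].
have finA : fin_nonempty A.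
  split; first exact: finite_fset.
  exists 0; rewrite /A /=; apply: (fsubsetP (sub_fat finN N0 _ _)).
  by apply: (fsubsetP (sub_fat finN N0 1 _)); rewrite inE.
have aA : admissible A by left.
have := Hk A aA _ _ (cylg n) (leqnn _) (fun v => id) point.
rewrite (Lm aA (cylg n).1) (Lm admT (cylg n).1) (bintZ (fm aA) _ bt) (bintZ (fm admT) _ bt).
rewrite -mulrBr normrM ger0_norm ?invr_ge0 ?(ltW n1)// ler_pM2l ?invr_gt0//.
rewrite distrC => hk; have := le_trans (ler_norm _) hk; rewrite lerBlDl => H.
apply: le_trans H _; rewrite lerD2r.
by apply: (trunc_moment_le (m1 aA)) => //; exact: hM.
Qed.

Let M0 : 0 <= M.
Proof.
rewrite -lee_fin; apply: le_trans moment_limit.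
by apply: integral_ge0 => x _; rewrite lee_fin powR_ge0.
Qed.

Lemma limit_integrable : (m setT).-integrable setT (EFin \o h).
Proof. exact: (moment_integrable (m1 admT) gamma1 mh moment_limit). Qed.

Lemma site_integrable A v : fin_nonempty A ->
  (m A).-integrable setT (EFin \o (h \o translate v)).
Proof.
move=> finA; have aA : admissible A by left.
apply: (moment_integrable (m1 aA) gamma1 _ (moment_translate v finA)).
exact: measurableT_comp mh (measurable_translate cX v).
Qed.

Local Notation Eh := (\int[m setT]_x h x).

Lemma trunc_mean_error K : 0 < K ->
  `|\int[m setT]_x trunc K h x - Eh| <= (K `^ (gamma - 1))^-1 * M.
Proof.
move=> K0; have bt : bdm K (trunc K h) by apply: trunc_bdm => //; exact: ltW.
have it := bdm_integrable (fm admT) bt; have ih := limit_integrable.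
rewrite distrC -RintegralB//.
have ihB : (m setT).-integrable setT (EFin \o (fun x => h x - trunc K h x)).
  have := integrableB measurableT ih it; apply: eq_integrable => // x _.
rewrite -lee_fin EFin_normr_Rintegral//.
apply: le_trans (le_abse_integral _ _ _) _ => //.
  by case/integrableP: ihB.
apply: le_trans (_ : \int[m setT]_x (((K `^ (gamma - 1))^-1)%:E * (`|h x| `^ gamma)%:E) <= _)%E.
  apply: ge0_le_integral => //.
  - by apply: measurableT_comp => //; case/integrableP: ihB.
  - by apply: measurable_funeM; exact/measurable_EFinP.
  - by move=> x _; rewrite lee_fin; exact: trunc_tail.
rewrite ge0_integralZl_EFin ?invr_ge0 ?powR_ge0//; last exact/measurable_EFinP.
by rewrite EFinM lee_wpmul2l ?lee_fin ?invr_ge0 ?powR_ge0//; exact: moment_limit.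
Qed.

Lemma weak_law_moment e : 0 < e -> exists2 dl : R, 0 < dl & forall A, fin_nonempty A ->
  (cardf (ext_boundary N A))%:R / (cardf A)%:R <= dl -> (cardf A)%:R^-1 <= dl ->
  (\int[m A]_x (`|average h (fset_set A) x - Eh|)%:E <= e%:E)%E.
Proof.
move=> e0.
(* [K] solves K^(gamma - 1) = 4 (M + 1) / e, so that tails cost at most e / 4; M + 1 keeps [T]
   positive when M = 0. *)
pose T := 4 * (M + 1) / e; have T0 : 0 < T by rewrite divr_gt0// mulr_gt0// ltr_wpDl.
pose K := T `^ (gamma - 1)^-1; have K0 : 0 < K by exact: powR_gt0.
have g10 : 0 < gamma - 1 by rewrite subr_gt0.
have KT : K `^ (gamma - 1) = T.
  by rewrite /K -powRrM mulVf ?gt_eqF// powRr1// ltW.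
pose kap := (K `^ (gamma - 1))^-1.
have kapM : kap * M <= e / 4.
  rewrite /kap KT /T invf_div mulrAC ler_pdivrMr ?mulr_gt0 ?ltr_wpDl//.
  rewrite (_ : e / 4 * (4 * (M + 1)) = e * (M + 1)); last by field.
  by rewrite ler_wpM2l ?(ltW e0)// lerDl.
have kap0 : 0 <= kap by rewrite invr_ge0 powR_ge0.
have bK : bdm K (trunc K h) by apply: trunc_bdm => //; exact: ltW.
pose F x := (K + 1)^-1 * trunc K h x.
have cF : cyl (fat 1 [fset 0]%fset) 1 F.
  by apply: cyl_rescale (ltW K0) bK _ => x y xy; rewrite /trunc (hD xy).
have K1 : 0 < K + 1 by rewrite ltr_wpDl// ltW.
have eK : 0 < e / 4 / (K + 1) by rewrite !divr_gt0.
have [dl dl0 Hdl] := weak_law cX finN N0 symN m1 LF Lm cF eK.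
exists dl => // A finA h1 h2; have {h1 h2}wl := Hdl A finA h1 h2.
have aA : admissible A by left.
have [fsA [a Aa]] := finA.
set B := fset_set A in wl *; pose b : R := #|` B|%:R.
have b0 : 0 < b.
  by rewrite ltr0n cardfs_gt0; apply/fset0Pn; exists a; rewrite in_fset_set// inE.
pose EF := \int[m setT]_x F x.
have EFK : (K + 1) * EF = \int[m setT]_x trunc K h x.
  by rewrite /EF (bintZ (fm admT) _ bK) mulrA mulfV ?mul1r// gt_eqF.
(* Three errors, each of integral at most e / 4: the tails at the sites of [B], the fluctuation of
   the truncated average, and the bias of the truncated mean. *)
have key x : `|average h B x - Eh| <=
    \sum_(v <- B) b^-1 * kap * `|h (translate v x)| `^ gamma +
    ((K + 1) * `|average F B x - EF| + e / 4).
  rewrite (_ : _ - _ = b^-1 * (\sum_(v <- B) (h (translate v x) - trunc K h (translate v x))) +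
     ((K + 1) * (average F B x - EF) + (\int[m setT]_x trunc K h x - Eh))); last first.
    rewrite mulrBr EFK sumrB mulrBr /average -/b.
    have -> : \sum_(v <- B) F (translate v x) = (K + 1)^-1 * \sum_(v <- B) trunc K h (translate v x).
      by rewrite mulr_sumr.
    rewrite [b^-1 * (_ * _)]mulrCA (mulrA (K + 1)) mulfV ?gt_eqF// mul1r.
    by set I := \int[_]_ _ _; ring.
  apply: le_trans (ler_normD _ _) _; apply: lerD.
    rewrite normrM ger0_norm ?invr_ge0 ?(ltW b0)// -mulr_sumr -mulrA.
    apply: ler_wpM2l; first by rewrite invr_ge0 ltW.
    apply: le_trans (ler_norm_sum _ _ _) _; rewrite mulr_sumr; apply: ler_sum => v _.
    exact: (trunc_tail h (translate v x) gamma1 K0).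
  apply: le_trans (ler_normD _ _) _; apply: lerD.
    by rewrite normrM (gtr0_norm K1).
  exact: le_trans (trunc_mean_error K0) kapM.
have mhv v : measurable_fun setT (fun x => h (translate v x)).
  exact: measurableT_comp mh (measurable_translate cX v).
have mav : measurable_fun setT (average h B).
  apply: measurable_funM => //.
  by apply: measurable_sum => v; exact: mhv.
have bW : bdm (1 + `|EF|) (fun x => `|average F B x - EF|).
  have [mW W1] := bdmB (bdm_average cX finN cF B) (bdm_cst EF).
  by split => [|x]; [exact: measurableT_comp|rewrite normr_id; exact: W1].
have bW' := bdmD (bdmZ (K + 1) bW) (bdm_cst (e / 4)).
apply: le_trans (_ : \int[m A]_x (\sum_(v <- B)
    ((b^-1 * kap)%:E * (`|h (translate v x)| `^ gamma)%:E) +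
    ((K + 1) * `|average F B x - EF| + e / 4)%:E) <= _)%E.
  apply: ge0_le_integral => //.
  - by apply/measurable_EFinP; apply: measurableT_comp => //; exact: measurable_funB.
  - apply: emeasurable_funD; last by apply/measurable_EFinP; case: bW'.
    apply: emeasurable_sum => v; apply: measurable_funeM.
    by apply/measurable_EFinP; exact: measurable_powR_norm.
  - move=> x _; under eq_bigr do rewrite -EFinM.
    by rewrite sumEFin -EFinD lee_fin; exact: key.
have bk0 : 0 <= b^-1 * kap by rewrite mulr_ge0// invr_ge0 ltW.
rewrite ge0_integralD//; last 4 first.
- by move=> x _; apply: sume_ge0 => v _; rewrite -EFinM lee_fin mulr_ge0// powR_ge0.
- apply: emeasurable_sum => v; apply: measurable_funeM.
  by apply/measurable_EFinP; exact: measurable_powR_norm.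
- by move=> x _; rewrite lee_fin addr_ge0 ?mulr_ge0// ?divr_ge0// ltW.
- by apply/measurable_EFinP; case: bW'.
rewrite (bdm_EFin (m1 aA) bW') (bintD (fm aA) (bdmZ _ bW) (bdm_cst _)).
rewrite (bintZ (fm aA) _ bW) Rintegral_cst// (m1 aA) mulr1.
rewrite ge0_integral_sum//; last 2 first.
- by move=> v; apply: measurable_funeM; apply/measurable_EFinP; exact: measurable_powR_norm.
- by move=> v x _; rewrite -EFinM lee_fin mulr_ge0// powR_ge0.
apply: le_trans (_ : ((kap * M)%:E + ((K + 1) * (e / 4 / (K + 1)) + e / 4)%:E <= _)%E).
  apply: leeD; last by rewrite lee_fin lerD2r ler_wpM2l// ltW.
  apply: le_trans (_ : \sum_(v <- B) (b^-1 * kap * M)%:E <= _)%E.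
    apply: lee_sum => v _; rewrite ge0_integralZl_EFin//; last first.
      by apply/measurable_EFinP; exact: measurable_powR_norm.
    rewrite (EFinM _ M); apply: lee_wpmul2l; first by rewrite lee_fin.
    exact: moment_translate.
  rewrite sumEFin lee_fin big_const_seq count_predT iter_addr_0 -mulr_natr -/b.
  by rewrite mulrC !mulrA mulfV ?mul1r// gt_eqF.
rewrite -EFinD lee_fin mulrCA mulfV ?gt_eqF// mulr1; lra.
Qed.

End weak_law_moment.

(** * The processes *)

Section processes.
Variables (R : realType) (X : ptopologicalType) (d : nat).
Local Notation V := 'rV[int]_d.
Local Notation S := (config V X).
Hypothesis cX : @second_countable X.
Variable nu : probability (borel X) R.

Lemma iid_law (dT : measure_display) (T : measurableType dT) (Pr : probability T R)
    (x0 : T -> S) : measurable_fun setT x0 -> iid_entries Pr nu x0 ->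
  exists mu : probability S R, (forall E, mu E = Pr (x0 @^-1` E)) /\
    forall (J : {fset V}) (B : V -> set (borel X)), (forall v, measurable (B v)) ->
    mu [set x | forall v, v \in J -> B v (x v)] = (\prod_(v <- J) nu (B v))%E.
Proof.
move=> mx0 [iid1 iid2].
pose phi : {mfun T >-> S} := HB.pack x0 (isMeasurableFun.Build _ _ _ _ x0 mx0).
exists (distribution Pr phi); split => // J B mB.
transitivity (Pr (\bigcap_(v in [set` J]) [set w | B v (x0 w v)])).
  by congr (Pr _); apply/seteqP; split => w /= h v; exact: h.
by rewrite iid2//; apply: eq_bigr => v _; rewrite iid1.
Qed.

(** The Markov property from time 0, with the sure event, shows the law at time [t] to be [P t]
    mixed over the initial law, which its box probabilities identify with [mu]. *)
Lemma markov_expectation (dT : measure_display) (T : measurableType dT)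
    (Pr : probability T R) (P : R -> R.-pker S ~> S) (xi : R -> T -> S)
    (mu : probability S R) (t M : R) (f : S -> R)
    (mxi : measurable_fun setT (xi t)) :
  markov_process Pr P xi -> iid_entries Pr nu (xi 0) ->
  (forall (J : {fset V}) (B : V -> set (borel X)), (forall v, measurable (B v)) ->
    mu [set x | forall v, v \in J -> B v (x v)] = (\prod_(v <- J) nu (B v))%E) ->
  0 <= t -> bdm M f ->
  \int[image_measure Pr mxi]_x f x = \int[mu]_x semigroup_op P t f x.
Proof.
move=> [mxis markov] iid mu_box t0 bf.
have m0 := mxis 0 (lexx 0).
pose m := image_measure Pr m0.
have mT (mx : measurable_fun setT (xi t)) : image_measure Pr mx setT = 1%E.
  exact: probability_setT.
have m1 : m setT = 1%E by exact: probability_setT.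
rewrite (bint_mixture (mu := m) (k := P t) m1 (mT mxi) _ bf) => [|B mB].
  apply: (law_unique cX mu_box _ (bdm_semigroup P t bf)) => J B mB.
  have [iid1 iid2] := iid.
  transitivity (Pr (\bigcap_(v in [set` J]) [set w | B v (xi 0 w v)])).
    by congr (Pr _); apply/seteqP; split => w /= h v; exact: h.
  by rewrite iid2//; apply: eq_bigr => v _; rewrite iid1.
have pT : past xi 0 setT by exact: (@measurableT _ (g_sigma_algebraType _)).
have := markov 0 t (lexx 0) t0 setT pT B mB.
rewrite setTI subr0 => E; apply: etrans E _.
rewrite ge0_integral_pushforward//; exact: measurable_kernel.
Qed.

Lemma semigroup_iter (P : R -> R.-pker S ~> S) (s M : R) (f : S -> R) k :
  markov_semigroup P -> 0 <= s -> bdm M f ->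
  semigroup_op P (k%:R * s) f = iter k (semigroup_op P s) f.
Proof.
move=> semiP s0 bf; elim: k => [|k ih].
  by apply/funext => x; rewrite mul0r (semigroup0 semiP _ bf).
apply/funext => x; rewrite -natr1 mulrDl mul1r addrC.
by rewrite (semigroupD semiP _ s0 _ bf) ?mulr_ge0// iterS ih.
Qed.

End processes.

(** * Non-empty boundaries and the final assembly *)

Lemma rV_mulrn_eq0 d (w : 'rV[int]_d) n : w *+ n = 0 -> (n == 0%N) || (w == 0).
Proof.
have [->//|n0 /matrixP ww] := eqVneq n 0%N; apply/eqP/matrixP => i j.
by have /eqP := ww i j; rewrite mulmxnE !mxE mulrn_eq0 (negbTE n0) => /eqP.
Qed.

(** An empty boundary would give A + w = A for some w <> 0 in [N]; summing the elements of both
    sides yields |A| w = 0, impossible without torsion. Consequently 1 / |A| is at most the boundary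
    ratio. *)
Lemma ext_boundary_gt0 (d : nat) (N A : set 'rV[int]_d) : finite_set N ->
  N !=set0 -> N <> [set 0] -> fin_nonempty A -> (0 < cardf (ext_boundary N A))%N.
Proof.
move=> finN [w0 Nw0] N1 [finA [a Aa]].
have [w Nw wn0] : exists2 w, N w & w != 0.
  apply: contrapT => h; apply: N1; apply/seteqP; split => [v Nv|v /= ->] /=.
    by apply/eqP; apply: contrapT => /negP v0; apply: h; exists v.
  suff <- : w0 = 0 by [].
  by apply/eqP; apply: contrapT => /negP v0; apply: h; exists w0.
have finB : finite_set (ext_boundary N A).
  exact: finite_ext_boundary.
rewrite cardfs_gt0; apply/negP => /eqP B0.
have sub v : A v -> A (v + w).
  move=> Av; apply: contrapT => nA.
  have : v + w \in fset_set (ext_boundary N A).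
    rewrite in_fset_set// inE; split => //; exists v => //; by exists w.
  by rewrite B0 inE.
pose B := fset_set A; have inB v : (v \in B) = (v \in A) by rewrite in_fset_set.
pose Bw := [fset (v + w)%R | v in B]%fset.
have BwB : Bw = B.
  apply/eqP; rewrite eqEfcard; apply/andP; split.
    apply/fsubsetP => _ /imfsetP[v /= vB ->]; move: vB; rewrite !inB !inE.
    exact: sub.
  by rewrite card_in_imfset //= => u v _ _ /addIr.
have : \sum_(v <- Bw) v = \sum_(v <- B) v by rewrite BwB.
rewrite big_imfset /=; last by move=> u v _ _ /addIr.
rewrite big_split /= -[RHS]addr0 => /addrI; rewrite big_const_seq count_predT iter_addr_0.
move=> /rV_mulrn_eq0; rewrite (negbTE wn0) orbF cardfs_eq0 => /eqP B00.
by have := inB a; rewrite B00 inE mem_set.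
Qed.

Theorem theorem3p1 (R : realType) (d : nat)
    (X : ptopologicalType) (polishX : polish_space R X)
    (N : set 'rV[int]_d) (finN : finite_set N) (N0 : N 0)
    (symN : forall v, N v -> N (- v))
    (alpha : R.-fker (config N X) ~> (config N X))
    (H : config N X -> R) (mH : measurable_fun [set: config N X] H)
    (tau : R) (tau_gt0 : 0 < tau)
    (nu : probability (borel X) R)
    (disp : set 'rV[int]_d -> measure_display)
    (Om : forall A, measurableType (disp A))
    (Pr : forall A, probability (Om A) R)
    (xi : forall A, R -> Om A -> config 'rV[int]_d X)
    (xiP : forall A, fin_nonempty A ->
       jump_process alpha (Pr A) A nu (xi A))
    (P : R -> R.-pker (config 'rV[int]_d X) ~> (config 'rV[int]_d X))
    (semiP : markov_semigroup P)
    (genP : has_generator P (gen alpha [set: 'rV[int]_d]))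
    (disp' : measure_display) (Om' : measurableType disp')
    (Pr' : probability Om' R)
    (xi' : R -> Om' -> config 'rV[int]_d X)
    (xi'P : limit_process Pr' P nu xi')
    (gamma : R) (gamma_gt1 : 1 < gamma)
    (moment : (ereal_sup
       [set 'E_(Pr A)[fun w => (`|H (restr N (xi A tau w))| `^ gamma)%R]
         | A in @fin_nonempty d] < +oo)%E)
    (A : nat -> set 'rV[int]_d) (A_fin : forall n, fin_nonempty (A n))
    (A_boundary : (cardf (ext_boundary N (A n)))%:R / (cardf (A n))%:R
       @[n --> \oo] --> (0 : R))
    (A_interior : forall n, interior_set N (Nset N (A n)) = A n)
    (* without this the claim fails for N = {0}, A_n = {0}; if N <> {0},
       |A_n| tends to infinity by A_boundary *)
    (A_large : N = [set 0] -> cardf (A n) @[n --> \oo] --> \oo) :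
  let Y n := fun w => (cardf (A n))%:R^-1 * statistic H (A n) (xi (A n) tau w) in
  let Z := fun w => H (restr N (xi' tau w)) in
  [/\ forall n, (Pr (A n)).-integrable setT (EFin \o Y n),
      Pr'.-integrable setT (EFin \o Z)
    & ('E_(Pr (A n))[fun w => (`|Y n w - fine 'E_Pr'[Z]|)%R]
        @[n --> \oo] --> 0)%E].
Proof.
have cX := polish_second_countable polishX.
have inv0 : (cardf (A n))%:R^-1 @[n --> \oo] --> (0 : R).
  have [N1|N1] := pselect (N = [set 0]).
    apply/cvgrPdist_le => e e0; near=> n.
    rewrite sub0r normrN ger0_norm ?invr_ge0//.
    have Kn : (Num.bound e^-1 <= cardf (A n))%N.
      near: n; exact: (A_large N1 _ (nbhs_infty_ge (Num.bound e^-1))).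
    have ei : e^-1 <= (cardf (A n))%:R.
      apply: le_trans (ltW (archi_boundP _)) _; first by rewrite invr_ge0 ltW.
      by rewrite ler_nat.
    by rewrite -[e]invrK lef_pV2// posrE ?invr_gt0//; apply: lt_le_trans ei; rewrite invr_gt0.
  apply: (squeeze_cvgr _ (cvg_cst 0) A_boundary).
  near=> n; rewrite invr_ge0 ler0n /= ler_peMl ?invr_ge0// ler1n.
  by apply: ext_boundary_gt0 => //; exists 0.
(* For d = 0 the lattice is a single site, and [setT] would be a finite active set with two
   competing processes; the vanishing of 1 / |A_n| excludes this. *)
have infV : ~ finite_set [set: 'rV[int]_d].
  move=> finV; have e0 : (0 : R) < (#|` fset_set [set: 'rV[int]_d]|%:R + 1)^-1.
    by rewrite invr_gt0 ltr_wpDl.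
  have /cvgrPdist_lt/(_ _ e0)[n _ /(_ n (leqnn n))] := inv0.
  have [finA [a Aa]] := A_fin n.
  have cA : (0 : R) < (cardf (A n))%:R.
    by rewrite ltr0n cardfs_gt0; apply/fset0Pn; exists a; rewrite in_fset_set// inE.
  rewrite sub0r normrN ger0_norm ?invr_ge0// ltf_pV2 ?posrE ?ltr_wpDl//.
  apply/negP; rewrite -leNgt; apply: le_trans (_ : #|` fset_set [set: 'rV[int]_d]|%:R <= _).
    rewrite ler_nat; apply: fsubset_leq_card; apply/fsubsetP => v _.
    by rewrite in_fset_set// inE.
  by rewrite lerDl.
have [c alphac] := measure_uub alpha.
have [mark' _ iid'] := xi'P; have mxi' := mark'.1.
have [mu [_ mu_box]] := iid_law (mxi' 0 (lexx 0)) iid'.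
have tau0 := ltW tau_gt0.
(* Each active set comes with its own semigroup and probability space; the semigroup and the law at
   time [tau] are selected by choice. The whole lattice receives those of the limit process, sets
   that are not admissible a dummy pair. *)
have mpf (B : set 'rV[int]_d) : exists Pm : (R -> R.-pker (config 'rV[int]_d X) ~> (config 'rV[int]_d X)) *
    {measure set (config 'rV[int]_d X) -> \bar R},
  (B = setT -> Pm.1 = P /\ exists mphi : measurable_fun setT (xi' tau),
     Pm.2 = image_measure Pr' mphi) /\
  (fin_nonempty B -> [/\ markov_semigroup Pm.1, has_generator Pm.1 (gen alpha B),
     exists mphi : measurable_fun setT (xi B tau), Pm.2 = image_measure (Pr B) mphi
     & forall M f, bdm M f -> \int[Pm.2]_x f x = \int[mu]_x semigroup_op Pm.1 tau f x]).
  have [BT|BT] := pselect (B = setT).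
    exists (P, image_measure Pr' (mxi' tau tau0)); split => [_|[finB _]].
      by split => //; exists (mxi' tau tau0).
    by exfalso; apply: infV; rewrite -BT.
  have [finB|nfinB] := pselect (fin_nonempty B); last first.
    by exists (P, image_measure Pr' (mxi' tau tau0)); split.
  have [[PB [semiB genB markB]] _ iidB] := xiP B finB.
  exists (PB, image_measure (Pr B) (markB.1 tau tau0)); split => // _; split => //.
    by exists (markB.1 tau tau0).
  by move=> M f bf; exact: (markov_expectation cX _ markB iidB mu_box tau0 bf).
have [Pm HPm] := choice mpf.
pose PP B := (Pm B).1; pose m B := (Pm B).2.
have [PT [mphiT mT]] := (HPm setT).1 erefl.
have semiA B : admissible B -> markov_semigroup (PP B).
  move=> [finB|->]; first by have [] := (HPm B).2 finB.
  by rewrite /PP PT.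
have genA B : admissible B -> has_generator (PP B) (gen alpha B).
  move=> [finB|->]; first by have [] := (HPm B).2 finB.
  by rewrite /PP PT.
have m1 B : admissible B -> m B setT = 1%E.
  move=> [finB|->]; rewrite /m; last by rewrite mT; exact: probability_setT.
  by have [_ _ [mphi ->] _] := (HPm B).2 finB; exact: probability_setT.
have mE B M f : admissible B -> bdm M f ->
    \int[m B]_x f x = \int[mu]_x semigroup_op (PP B) tau f x.
  move=> [finB|->] bf; first by have [_ _ _ hE] := (HPm B).2 finB; exact: hE bf.
  by rewrite /m mT /PP PT; exact: (markov_expectation cX _ mark' iid' mu_box tau0 bf).
pose q := #|` fset_set N|.
(* Steps of length tau / k meet the threshold 2 c q^2 s <= 1/4 once k is at least 8 c q^2 tau; the
   successor makes k positive. *)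
pose k := (Num.bound (8 * c * q%:R * q%:R * tau)).+1.
have c0 := c_ge0 alphac.
have k0 : (0 : R) < k%:R by rewrite ltr0n.
pose s := tau / k%:R.
have s0 : 0 <= s by rewrite divr_ge0.
have ks : k%:R * s = tau by rewrite mulrC divfK// gt_eqF.
have cs : 2 * c * q%:R * q%:R * s <= 4^-1.
  rewrite /s mulrA ler_pdivrMr//.
  have h : 8 * c * q%:R * q%:R * tau <= k%:R.
    apply: le_trans (ltW (archi_boundP _)) _; first by rewrite !mulr_ge0.
    by rewrite ler_nat.
  rewrite ler_pdivlMl//; apply: le_trans h.
  by rewrite (_ : 4 * _ = 8 * c * q%:R * q%:R * tau)//; ring.
(* The mean at time [tau], written as k short steps integrated against the initial law; the
   configuration argument is a dummy that gives it the shape of a step. *)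
pose L B (f : config 'rV[int]_d X -> R) (x : config 'rV[int]_d X) :=
  \int[mu]_x iter k (semigroup_op (PP B) s) f x.
have LF : local_family N L.
  have step := local_family_semigroup cX finN N0 symN alphac semiA genA s0 cs.
  exact: (local_family_comp cX finN N0 (local_family_law cX mu_box N)
    (local_family_iter cX finN N0 k step)).
have Lm B : admissible B -> forall f, bdm 1 f -> forall x, L B f x = \int[m B]_y f y.
  move=> aB f bf x; rewrite (mE B 1 f aB bf) /L -ks.
  by rewrite (semigroup_iter k (semiA B aB) s0 bf).
pose h (x : config 'rV[int]_d X) : R := H (restr N x).
have mh : measurable_fun setT h by exact: measurableT_comp mH (measurable_restr (N := N) cX).
have hD x y : (forall v, v \in fat N 1 [fset 0]%fset -> x v = y v) -> h x = h y.
  move=> xy; congr (H _); apply/funext => w; apply: xy; apply/dilP => //.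
  by exists 0; rewrite ?inE// subr0; exact: (set_valP w).
have mhg : measurable_fun setT (fun x => (`|h x| `^ gamma)%:E).
  by apply/measurable_EFinP; exact: measurable_powR_norm.
pose sup := (ereal_sup [set 'E_(Pr B)[fun w => (`|H (restr N (xi B tau w))| `^ gamma)%R]
         | B in @fin_nonempty d])%E.
have sup_ge B : fin_nonempty B -> (\int[m B]_x (`|h x| `^ gamma)%:E <= sup)%E.
  move=> finB; have [_ _ [mphi mB] _] := (HPm B).2 finB.
  apply: ereal_sup_ubound; exists B => //.
  by rewrite unlock /m mB ge0_integral_pushforward.
have sup_fin : sup \is a fin_num.
  rewrite ge0_fin_numE//; apply: le_trans (sup_ge _ (A_fin 0%N)).
  by apply: integral_ge0 => x _; rewrite lee_fin powR_ge0.
have hM B : fin_nonempty B -> (\int[m B]_x (`|h x| `^ gamma)%:E <= (fine sup)%:E)%E.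
  by move=> finB; rewrite fineK//; exact: sup_ge.
have ihT := limit_integrable finN N0 m1 LF Lm gamma_gt1 mh hD hM.
have wl e : 0 < e -> _ := weak_law_moment cX finN N0 symN m1 LF Lm gamma_gt1 mh hD hM (e := e).
move=> Y Z.
have EZ : fine 'E_Pr'[Z] = \int[m setT]_x h x.
  rewrite unlock /m mT /Rintegral; congr fine.
  rewrite integral_pushforward//; first exact/measurable_EFinP.
  by move: ihT; rewrite /m mT => /integrable_image.
have YE n w : Y n w = average h (fset_set (A n)) (xi (A n) tau w).
  rewrite /Y /average; congr (_ * _); rewrite /statistic fsbig_finite; last by case: (A_fin n).
  by apply: eq_bigr => v _.
split.
- move=> n; have finA := A_fin n; have aA : admissible (A n) by left.
  have [_ _ [mphi mB] _] := (HPm (A n)).2 finA.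
  have iav : (m (A n)).-integrable setT (EFin \o average h (fset_set (A n))).
    have -> : EFin \o average h (fset_set (A n)) = (fun x => ((cardf (A n))%:R^-1)%:E *
        \sum_(v <- fset_set (A n)) (EFin \o (h \o translate v)) x)%E.
      by apply/funext => x /=; rewrite sumEFin -EFinM.
    apply: integrableZl => //; apply: integrable_sum => // v _.
    exact: (site_integrable cX m1 LF Lm gamma_gt1 mh hD hM v finA).
  move: iav; rewrite /m mB => /integrable_image.
  by apply: eq_integrable => // w _ /=; rewrite YE.
- by move: ihT; rewrite /m mT => /integrable_image.
- have EY n : ('E_(Pr (A n))[fun w => (`|Y n w - fine 'E_Pr'[Z]|)%R] =
      \int[m (A n)]_x (`|average h (fset_set (A n)) x - \int[m setT]_x h x|)%:E)%E.
    have [_ _ [mphi mB] _] := (HPm (A n)).2 (A_fin n).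
    rewrite EZ unlock /m mB ge0_integral_pushforward//.
      by apply: eq_integral => w _ /=; rewrite YE.
    apply/measurable_EFinP; apply: measurableT_comp => //.
    apply: measurable_funB => //; apply: measurable_funM => //.
    by apply: measurable_sum => v; exact: measurableT_comp mh (measurable_translate cX v).
  under eq_fun do rewrite EY.
  set I := fun n => _.
  have I0 n : (0 <= I n)%E by apply: integral_ge0 => x _; rewrite lee_fin.
  have Ie e : 0 < e -> \forall n \near \oo, (I n <= e%:E)%E.
    move=> e0; have [dl dl0 Hdl] := wl e e0.
    near=> n; apply: Hdl => //.
      near: n; have /cvgrPdist_le/(_ _ dl0) := A_boundary; apply: filterS => n.
      by rewrite sub0r normrN; apply: le_trans; exact: ler_norm.
    near: n; have /cvgrPdist_le/(_ _ dl0) := inv0; apply: filterS => n.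
    by rewrite sub0r normrN; apply: le_trans; exact: ler_norm.
  apply/fine_cvgP; split.
    have := Ie 1 ltr01; apply: filterS => n I1.
    by rewrite ge0_fin_numE//; apply: le_lt_trans I1 _; rewrite ltry.
  apply/cvgrPdist_le => e e0; have := Ie e e0; apply: filterS => n Ine.
  rewrite sub0r normrN /= ger0_norm ?fine_ge0// -lee_fin fineK//.
  by rewrite ge0_fin_numE//; apply: le_lt_trans Ine _; rewrite ltry.
Unshelve. all: by end_near.
Qed.
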